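(* Let $\mathsf G,c>0$, and let $(\mathcal M,\mathbf g)$ be a smooth static, spherically symmetric Lorentzian manifold $\mathcal M\cong\mathbb R\times(\mathbb R^3\setminus\overline{B_{\rho_0}(0)})$, $\rho_0>0$, described in spatially conformally flat coordinates. Suppose that in area-radius coordinates $(t,r,\vartheta,\varphi)$, $t\in\mathbb R$, $r\in(0,\infty)$, the metric $\mathbf g$ is of the form $$ds_{\mathbf g}^2=-e^{2\alpha(r)}c^2dt^2+e^{-2\alpha(r)}dr^2+r^2(d\vartheta^2+\sin^2\vartheta\,d\varphi^2),\qquad e^{2\alpha(r)}=1-\frac{2\mathsf Gm(r)}{c^2r},$$ and that the cumulative mass function $m$ has an absolutely converging power series expansion $$m(r)=m_0+m_1r+m_2r^2+O(r^3)\qquad\text{as }r\downarrow0,$$ with $m_0<0$. Then the twice-contracted second Bianchi identity holds weakly on $\mathcal M$.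
   Context: Spatially conformally flat coordinates $(t,\rho,\vartheta,\varphi)$, $\rho\in(\rho_0,\infty)$: given by $\rho(r)=\rho_0\exp\Big(\int_0^r\frac{dr'}{\sqrt{r'^2-\frac{2\mathsf G}{c^2}r'm(r')}}\Big)$ (with $\rho_0>0$ fixed); in these coordinates the metric reads $-e^{2\gamma(\rho)}c^2dt^2+\phi^4(\rho)[d\rho^2+\rho^2(d\vartheta^2+\sin^2\vartheta\,d\varphi^2)]$ with $\phi=\sqrt{r/\rho}$ and $\gamma(\rho)=\alpha(r(\rho))$. The metric is smooth on $\mathcal M$, so $m$ is smooth on $(0,\infty)$ and $1-\frac{2\mathsf Gm(r)}{c^2r}>0$ there. $\overline{\mathcal M}\cong\mathbb R\times(\mathbb R^3\setminus B_{\rho_0}(0))$ is $\mathcal M$ with its interior boundary $\rho=\rho_0$ (i.e. $r=0$), and $\mathfrak X_c(\overline{\mathcal M})$ is the set of vector fields smooth on $\overline{\mathcal M}$ (up to and including the boundary, in the coordinates built from $\rho$) with compact support in $\overline{\mathcal M}$. Definition. Let $G^\mu{}_\nu=R^\mu{}_\nu-\frac12R\,\delta^\mu{}_\nu$ be the Einstein tensor of $\mathbf g$. The twice-contracted second Bianchi identity holds weakly on $\mathcal M$ if for every $\psi\in\mathfrak X_c(\overline{\mathcal M})$ the integral $\int_{\mathcal M}G^\mu{}_\nu\nabla_\mu\psi^\nu\,d\mathrm{vol}_{\mathbf g}$ exists and equals $\lim_{\varepsilon\to0}\int_{\mathcal T_\varepsilon}i_X(d\mathrm{vol}_{\mathbf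 g})$, and both equal $0$. Here $X^\mu=G^\mu{}_\nu\psi^\nu$, $i_X$ is the interior product, and $\mathcal T_\varepsilon\cong\mathbb R\times\partial B_{\rho_0+\varepsilon}(0)$ is oriented as the boundary of $\mathbb R\times(\mathbb R^3\setminus\overline{B_{\rho_0+\varepsilon}(0)})$. *)

(* Defs.v *)
From HB Require Import structures.
From mathcomp Require Import all_boot all_order all_algebra.
From mathcomp Require Import all_classical all_reals all_analysis.

Set Implicit Arguments.
Unset Strict Implicit.
Unset Printing Implicit Defensive.

Import Order.TTheory GRing.Theory Num.Theory.
Import numFieldNormedType.Exports.

Local Open Scope classical_set_scope.
Local Open Scope ring_scope.

Section Smoothness.
Context {R : realType} {n : nat}.

Definition partial (i : 'I_n) (f : 'rV[R]_n -> R) (p : 'rV[R]_n) : R :=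
  'D_(delta_mx 0 i) f p.

Definition iter_partial (s : seq 'I_n) (f : 'rV[R]_n -> R) : 'rV[R]_n -> R :=
  foldr partial f s.

(* C^oo on the open set U; 'D is a total operator, hence the explicit
   derivability condition. *)
Definition smooth_on_open (U : set 'rV[R]_n) (f : 'rV[R]_n -> R) : Prop :=
  forall (s : seq 'I_n) (p : 'rV[R]_n), U p ->
    {for p, continuous (iter_partial s f)} /\
    forall i : 'I_n, derivable (iter_partial s f) p (delta_mx 0 i).

(* C^oo on an arbitrary set A (possibly with boundary): near each point of A,
   f is the restriction of a function that is smooth on an open set. *)
Definition smooth_on (A : set 'rV[R]_n) (f : 'rV[R]_n -> R) : Prop :=
  forall p, A p -> exists (U : set 'rV[R]_n) (F : 'rV[R]_n -> R),
    [/\ open U, U p, smooth_on_open U F & {in A `&` U, F =1 f}].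

End Smoothness.

(* Tensor calculus in a global chart on an open subset of R^n: [g p i j] is
   g_ij at p, and a vector field is the row of its components. *)
Section TensorCalculus.
Context {R : realType} {n : nat}.
Variable g : 'rV[R]_n -> 'M[R]_n.

Definition inv_metric (i j : 'I_n) (p : 'rV[R]_n) : R := invmx (g p) i j.

(* christoffel k i j = Gamma^k_ij *)
Definition christoffel (k i j : 'I_n) (p : 'rV[R]_n) : R :=
  2^-1 * \sum_l inv_metric k l p *
    (partial i (fun q => g q l j) p + partial j (fun q => g q l i) p
     - partial l (fun q => g q i j) p).

(* riemann a b c d = R^a_bcd *)
Definition riemann (a b c d : 'I_n) (p : 'rV[R]_n) : R :=
  partial c (christoffel a d b) p - partial d (christoffel a c b) p
  + \sum_e (christoffel a c e p * christoffel e d b p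
            - christoffel a d e p * christoffel e c b p).

Definition ricci (b d : 'I_n) (p : 'rV[R]_n) : R := \sum_a riemann a b a d p.

(* ricci_mixed mu nu = R^mu_nu *)
Definition ricci_mixed (mu nu : 'I_n) (p : 'rV[R]_n) : R :=
  \sum_s inv_metric mu s p * ricci s nu p.

Definition scalar_curvature (p : 'rV[R]_n) : R := \sum_mu ricci_mixed mu mu p.

(* einstein mu nu = G^mu_nu *)
Definition einstein (mu nu : 'I_n) (p : 'rV[R]_n) : R :=
  ricci_mixed mu nu p - 2^-1 * scalar_curvature p * (mu == nu)%:R.

(* cov_deriv psi mu nu = nabla_mu psi^nu *)
Definition cov_deriv (psi : 'rV[R]_n -> 'rV[R]_n) (mu nu : 'I_n)
    (p : 'rV[R]_n) : R :=
  partial mu (fun q => psi q 0 nu) p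
  + \sum_l christoffel nu mu l p * psi p 0 l.

Definition einstein_cov_deriv (psi : 'rV[R]_n -> 'rV[R]_n)
    (p : 'rV[R]_n) : R :=
  \sum_mu \sum_nu einstein mu nu p * cov_deriv psi mu nu p.

(* X^mu = G^mu_nu psi^nu *)
Definition einstein_flux_field (psi : 'rV[R]_n -> 'rV[R]_n) (p : 'rV[R]_n) :
    'rV[R]_n :=
  \row_mu \sum_nu einstein mu nu p * psi p 0 nu.

Definition vol_density (p : 'rV[R]_n) : R := Num.sqrt `|\det (g p)|.

(* dvol_g at p, evaluated on the rows of V *)
Definition vol_form (p : 'rV[R]_n) (V : 'M[R]_n) : R := vol_density p * \det V.

(* pullback F q = F^* g at q; row i of 'J F q is the i-th partial of F *)
Definition pullback (F : 'rV[R]_n -> 'rV[R]_n) (q : 'rV[R]_n) : 'M[R]_n :=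
  'J F q *m g (F q) *m ('J F q)^T.

End TensorCalculus.

Section Spacetime.
Context {R : realType}.

Definition row4 (a b c d : R) : 'rV[R]_4 :=
  \row_j nth 0 [:: a; b; c; d] j.

(* The events are p = (t, x1, x2, x3), with rho = |(x1, x2, x3)|. *)
Definition rho_of (p : 'rV[R]_4) : R :=
  Num.sqrt (p 0 1 ^+ 2 + p 0 2 ^+ 2 + p 0 3 ^+ 2).

Definition spacetime (rho0 : R) : set 'rV[R]_4 := [set p | rho0 < rho_of p].

Definition closed_spacetime (rho0 : R) : set 'rV[R]_4 :=
  [set p | rho0 <= rho_of p].

(* The chart (t, s, theta, phi) |-> (t, x), where x has polar angles theta, phi
   and |x| = f s. *)
Definition spherical_chart (f : R -> R) (q : 'rV[R]_4) : 'rV[R]_4 :=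
  row4 (q 0 0)
       (f (q 0 1) * (sin (q 0 2) * cos (q 0 3)))
       (f (q 0 1) * (sin (q 0 2) * sin (q 0 3)))
       (f (q 0 1) * cos (q 0 2)).

Definition smooth_lorentzian_metric (M : set 'rV[R]_4)
    (g : 'rV[R]_4 -> 'M[R]_4) : Prop :=
  (forall i j, smooth_on_open M (fun p => g p i j)) /\
  forall p, M p -> (g p)^T = g p /\
    exists2 P : 'M[R]_4, P \in unitmx &
      P *m g p *m P^T = diag_mx (row4 (- 1) 1 1 1).

(* - e^(2 gamma(rho)) c^2 dt^2
   + phi(rho)^4 [drho^2 + rho^2 (dtheta^2 + sin^2 theta dvarphi^2)] *)
Definition conformally_flat_form (c rho0 : R) (gamma phi : R -> R)
    (g : 'rV[R]_4 -> 'M[R]_4) : Prop :=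
  forall t rho theta varphi : R, rho0 < rho -> 0 < theta < pi ->
    pullback g (spherical_chart id) (row4 t rho theta varphi) =
    diag_mx (row4 (- expR (2 * gamma rho) * c ^+ 2)
                  (phi rho ^+ 4)
                  (phi rho ^+ 4 * rho ^+ 2)
                  (phi rho ^+ 4 * (rho ^+ 2 * sin theta ^+ 2))).

(* - e^(2 alpha(r)) c^2 dt^2 + e^(- 2 alpha(r)) dr^2
   + r^2 (dtheta^2 + sin^2 theta dvarphi^2), where the sphere of area radius r
   sits at coordinate radius rho r *)
Definition area_radius_form (c : R) (alpha rho : R -> R)
    (g : 'rV[R]_4 -> 'M[R]_4) : Prop :=
  forall t r theta varphi : R, 0 < r -> 0 < theta < pi ->
    pullback g (spherical_chart rho) (row4 t r theta varphi) =
    diag_mx (row4 (- expR (2 * alpha r) * c ^+ 2)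
                  (expR (- (2 * alpha r)))
                  (r ^+ 2)
                  (r ^+ 2 * sin theta ^+ 2)).

(* rho(r); the integrand is unbounded at 0, so this is a Lebesgue integral over
   the open interval. *)
Definition conformal_radius (G c rho0 : R) (m : R -> R) (r : R) : R :=
  rho0 * expR (\int[lebesgue_measure]_(s in `]0, r[)
                 (Num.sqrt (s ^+ 2 - 2 * G / c ^+ 2 * s * m s))^-1)%R.

(* f : (0, oo) -> (rho0, oo) is a bijection with inverse h *)
Definition radial_inverse (rho0 : R) (f h : R -> R) : Prop :=
  (forall r, 0 < r -> rho0 < f r /\ h (f r) = r) /\
  (forall rho, rho0 < rho -> 0 < h rho /\ f (h rho) = rho).

Definition smooth_on_pos (m : R -> R) : Prop :=
  forall (k : nat) (r : R), 0 < r -> derivable (m^`(k))%classic r 1.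

Definition abs_power_series_at0 (m : R -> R) (a : nat -> R) : Prop :=
  exists2 delta : R, 0 < delta & forall r : R, 0 < r < delta ->
    cvgn [normed series (fun k => a k * r ^+ k)] /\
    series (fun k => a k * r ^+ k) @ \oo --> m r.

(* Smooth up to and including the boundary, with compact support there; the
   values of psi outside closed_spacetime rho0 are irrelevant. *)
Definition test_field (rho0 : R) (psi : 'rV[R]_4 -> 'rV[R]_4) : Prop :=
  (forall i, smooth_on (closed_spacetime rho0) (fun p => psi p 0 i)) /\
  compact (closure (closed_spacetime rho0 `&` [set p | psi p != 0])).

Local Notation leb := (@lebesgue_measure R).
Local Notation lebesgue4 := (leb \x leb \x leb \x leb)%E.
Local Notation lebesgue3 := (leb \x leb \x leb)%E.

Definition point4 (z : R * R * R * R) : 'rV[R]_4 :=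
  row4 z.1.1.1 z.1.1.2 z.1.2 z.2.

Definition bulk_domain (rho0 : R) : set (R * R * R * R) :=
  point4 @^-1` spacetime rho0.

Definition bulk_integrand (g : 'rV[R]_4 -> 'M[R]_4)
    (psi : 'rV[R]_4 -> 'rV[R]_4) (z : R * R * R * R) : R :=
  einstein_cov_deriv g psi (point4 z) * vol_density g (point4 z).

Definition bulk_integrable (rho0 : R) (g : 'rV[R]_4 -> 'M[R]_4)
    (psi : 'rV[R]_4 -> 'rV[R]_4) : Prop :=
  lebesgue4.-integrable (bulk_domain rho0) (EFin \o bulk_integrand g psi).

Definition bulk_integral (rho0 : R) (g : 'rV[R]_4 -> 'M[R]_4)
    (psi : 'rV[R]_4 -> 'rV[R]_4) : R :=
  (\int[lebesgue4]_(z in bulk_domain rho0) bulk_integrand g psi z)%R.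

(* The hypersurface T = R x (sphere of radius rho) is parametrized by
   (t, theta, varphi).  As boundary of R x {|x| > rho} its outward normal is
   -d_rho, and (-d_rho, d_t, d_theta, d_varphi) is positive for the orientation
   (d_t, d_rho, d_theta, d_varphi) of the spacetime, so the parametrization
   preserves orientation. *)
Definition tube_domain : set (R * R * R) :=
  [set: R] `*` `]0, pi[ `*` `]0, 2 * pi[.

(* (i_X dvol_g)(d_t, d_theta, d_varphi) *)
Definition tube_integrand (g : 'rV[R]_4 -> 'M[R]_4)
    (X : 'rV[R]_4 -> 'rV[R]_4) (rho : R) (z : R * R * R) : R :=
  let q := row4 z.1.1 rho z.1.2 z.2 in
  let p := spherical_chart id q in
  let J := 'J (spherical_chart id) q in
  vol_form g p (\matrix_i nth 0 [:: X p; row 0 J; row 2 J; row 3 J] i).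

Definition tube_integrable (g : 'rV[R]_4 -> 'M[R]_4)
    (X : 'rV[R]_4 -> 'rV[R]_4) (rho : R) : Prop :=
  lebesgue3.-integrable tube_domain (EFin \o tube_integrand g X rho).

Definition tube_integral (g : 'rV[R]_4 -> 'M[R]_4)
    (X : 'rV[R]_4 -> 'rV[R]_4) (rho : R) : R :=
  (\int[lebesgue3]_(z in tube_domain) tube_integrand g X rho z)%R.

Definition weak_bianchi (rho0 : R) (g : 'rV[R]_4 -> 'M[R]_4) : Prop :=
  forall psi : 'rV[R]_4 -> 'rV[R]_4, test_field rho0 psi ->
    let X := einstein_flux_field g psi in
    [/\ bulk_integrable rho0 g psi,
        forall eps : R, 0 < eps -> tube_integrable g X (rho0 + eps),
        tube_integral g X (rho0 + eps) @[eps --> 0^'+]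
          --> bulk_integral rho0 g psi
      & bulk_integral rho0 g psi = 0].

End Spacetime.

(* Main.v *)
(* In Cartesian coordinates the metric is diag(-N, S, S, S) with N and S radial.
   Writing k = G / c^2, r for the area radius and W = sqrt (r^2 - 2 k r m), the
   mixed Einstein tensor times the volume density has eigenvalue
   - 2 k c W m' / rho^3 on d_t and d_rho, and - k c W r m'' / rho^3 on the spheres.
   Since dr/drho = W / rho, the rho-derivatives of W, r and of the derivatives of m
   are polynomials in these quantities divided by rho, so both eigenvalues and their
   derivatives stay bounded up to the boundary, and the eigenvalues themselves vanish
   there because W does.  The pointwise Bianchi identity makes the bulk integrand the
   coordinate divergence of the density flux.  Each summand of this divergence is
   bounded with bounded support, and integrates to 0 along every coordinate line by the
   fundamental theorem of calculus, because the flux vanishes where the line meets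
   the boundary; Fubini's theorem concludes.  The tube integral is bounded by a
   constant times the first eigenvalue. *)
Require Import Defs.
From HB Require Import structures.
From mathcomp Require Import all_boot all_order all_algebra.
From mathcomp Require Import all_classical all_reals all_analysis.
From mathcomp Require Import measurable_realfun ring lra.

Set Implicit Arguments.
Unset Strict Implicit.
Unset Printing Implicit Defensive.

Import Order.TTheory GRing.Theory Num.Theory.
Import numFieldNormedType.Exports.

Local Open Scope classical_set_scope.
Local Open Scope ring_scope.

(** * Differential calculus in coordinates *)

(** The hypotheses describe [g] through pullbacks by the spherical chart, which degenerates on the
    axis; the axis is reached by continuity, and from then on all computations are Cartesian.
    Logarithmic derivatives of N and S are stored divided by rho, so that each partial derivative of
    a radial function is a coefficient times a coordinate, and curvature becomes a finite check of
    rational identities.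

    The obstacle is that W and r vanish at the boundary: the Christoffel symbols contain 1/W and the
    Einstein eigenvalues contain 1/r^2 and 1/r, so neither can be estimated alone. Only the Einstein
    tensor times the volume density, whose factor W r^2 removes these poles, is ever bounded, and
    the Bianchi identity trades the Christoffel terms for derivatives of that product before any
    estimate is made. The expansion of m enters as boundedness of m and its first three derivatives
    near r = 0.

    Integrating along coordinate lines keeps the divergence theorem one-dimensional: such a line
    meets rho > rho0 in nothing, in the whole line, or in two half-lines. *)

Lemma sum_ord4 (V : nmodType) (f : 'I_4 -> V) : \sum_i f i = f 0 + f 1 + f 2 + f 3.
Proof.
rewrite !big_ord_recl big_ord0 addr0 !addrA.
by do 3?[congr (_ + _)]; congr f; apply: val_inj.
Qed.

Lemma ord4_ind (P : 'I_4 -> Prop) : P 0 -> P 1 -> P 2 -> P 3 -> forall i, P i.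
Proof.
move=> P0 P1 P2 P3; case=> [[|[|[|[|//]]]] lti];
  [move: P0|move: P1|move: P2|move: P3]; congr P; exact: val_inj.
Qed.

Lemma row4E (R : realType) (a b c d : R) :
  ((row4 a b c d 0 0 = a) * (row4 a b c d 0 1 = b) *
   (row4 a b c d 0 2 = c) * (row4 a b c d 0 3 = d))%type.
Proof. by rewrite !mxE. Qed.

Lemma invmx_diag (F : fieldType) n (d : 'rV[F]_n) : (forall i, d 0 i != 0) ->
  invmx (diag_mx d) = diag_mx (\row_i (d 0 i)^-1).
Proof.
move=> d0.
have dV : diag_mx d *m diag_mx (\row_i (d 0 i)^-1) = 1%:M.
  rewrite mulmx_diag; apply/matrixP => i j; rewrite !mxE.
  by have [->|//] := eqVneq i j; rewrite mulfV.
have /mulmx1_unit[du _] := dV.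
by rewrite -[RHS]mul1mx -(mulVmx du) -mulmxA dV mulmx1.
Qed.

Lemma ler_norm_entry (R : realType) n (p : 'rV[R]_n) i : `|p 0 i| <= `|p|.
Proof.
rewrite [leRHS]/Num.Def.normr /= mx_normrE.
exact: (le_bigmax _ (fun ij : 'I_1 * 'I_n => `|p ij.1 ij.2|) (0, i)).
Qed.

Section PointwiseDerivatives.
Context {R : realType} {V : normedModType R}.
Implicit Types (f g : V -> R) (x v : V) (a b c : R).

(** This family fixes pointwise forms, with products instead of scalings, so that derivatives of
    long expressions can be assembled as terms and compared by [ring] or [field]. *)
Lemma is_derive_add f g x v a b : is_derive x v f a -> is_derive x v g b ->
  is_derive x v (fun y => f y + g y) (a + b).
Proof. exact: is_deriveD. Qed.

Lemma is_derive_sub f g x v a b : is_derive x v f a -> is_derive x v g b ->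
  is_derive x v (fun y => f y - g y) (a - b).
Proof. exact: is_deriveB. Qed.

Lemma is_derive_opp f x v a : is_derive x v f a ->
  is_derive x v (fun y => - f y) (- a).
Proof. exact: is_deriveN. Qed.

Lemma is_derive_mul f g x v a b : is_derive x v f a -> is_derive x v g b ->
  is_derive x v (fun y => f y * g y) (f x * b + g x * a).
Proof. exact: is_deriveM. Qed.

Lemma is_derive_const c x v : is_derive x v (fun=> c) 0.
Proof. exact: is_derive_cst. Qed.

Lemma is_derive_mull c f x v a : is_derive x v f a ->
  is_derive x v (fun y => c * f y) (c * a).
Proof. exact: is_deriveZ. Qed.

Lemma is_derive_sqr f x v a : is_derive x v f a ->
  is_derive x v (fun y => f y ^+ 2) (2 * f x * a).
Proof.
move=> df; apply: (@is_derive_eq _ _ _ _ _ _ _ _ (is_derive_mul df df)).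
by ring.
Qed.

Lemma is_derive_inv f x v a : f x != 0 -> is_derive x v f a ->
  is_derive x v (fun y => (f y)^-1) (- (f x ^- 2 * a)).
Proof.
move=> fx0 [df <-]; split; first exact: derivableV.
by rewrite deriveV // scaleNr.
Qed.

Lemma is_derive_div f g x v a b : g x != 0 ->
  is_derive x v f a -> is_derive x v g b ->
  is_derive x v (fun y => f y / g y) ((a * g x - f x * b) / g x ^+ 2).
Proof.
move=> gx0 df dg; apply: is_derive_eq.
  exact: is_derive_mul df (is_derive_inv gx0 dg).
by rewrite /=; field.
Qed.

Lemma partialP n (f : 'rV[R]_n -> R) p i a :
  is_derive p (delta_mx 0 i) f a -> partial i f p = a.
Proof. by case. Qed.

Lemma is_derive_entry n (i j : 'I_n) (p : 'rV[R]_n) :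
  is_derive p (delta_mx 0 i) (fun q => q 0 j) (i == j)%:R.
Proof.
have quot : (fun h => h^-1 *: ((h *: delta_mx 0 i + p : 'rV_n) 0 j - p 0 j)) @ 0^'
    --> ((i == j)%:R : R).
  apply: cvg_near_cst; near=> h.
  have h0 : h != 0 by near: h; exact: nbhs_dnbhs_neq.
  by rewrite !mxE eqxx addrK eq_sym; apply: mulKf.
split; first by apply/cvg_ex; eexists; exact: quot.
exact: (cvg_lim (@Rhausdorff R) quot).
Unshelve. all: by end_near. Qed.

End PointwiseDerivatives.

(** * Curvature of diag(-N, S, S, S) in Cartesian coordinates *)

Section StaticMetric.
Context {R : realType}.
Variables (M : set 'rV[R]_4) (g : 'rV[R]_4 -> 'M[R]_4).
Variables N S u v u1 v1 : 'rV[R]_4 -> R.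
Local Notation e_ i := (delta_mx (0 : 'I_1) (i : 'I_4) : 'rV[R]_4).

(** Setting the time component to 0 gives all four partial derivatives of a radial function the same
    shape, a coefficient times [X p i]. *)
Definition space_coord (p : 'rV[R]_4) (i : 'I_4) : R := if i == 0 then 0 else p 0 i.
Local Notation X := space_coord.

Hypothesis openM : open M.
Hypothesis gE : forall p, M p -> g p = diag_mx (row4 (- N p) (S p) (S p) (S p)).
Hypothesis N0 : forall p, M p -> N p != 0.
Hypothesis S0 : forall p, M p -> S p != 0.
(** For radial N and S these say u = N' / (2 rho N) and v = S' / (2 rho S); [u1] and [v1] are
    likewise u' / rho and v' / rho. *)
Hypothesis dN : forall p, M p -> forall i,
  is_derive p (e_ i) N (2 * N p * u p * X p i).
Hypothesis dS : forall p, M p -> forall i,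
  is_derive p (e_ i) S (2 * S p * v p * X p i).
Hypothesis du : forall p, M p -> forall i, is_derive p (e_ i) u (u1 p * X p i).
Hypothesis dv : forall p, M p -> forall i, is_derive p (e_ i) v (v1 p * X p i).

Let M_near p : M p -> \near p, M p.
Proof. by move=> Mp; apply: open_nbhs_nbhs. Qed.

(** For i different from k, [kap k] is the coefficient of X_i in Gamma^k_ki, and [tau i] is minus
    that of X_k in Gamma^k_ii; the suffix 1 marks their slopes. *)
Let kap (k : 'I_4) p := if k == 0 then u p else v p.
Let tau (k : 'I_4) p := if k == 0 then - (N p / S p * u p) else v p.
Let kap1 (k : 'I_4) p := if k == 0 then u1 p else v1 p.
Let tau1 (k : 'I_4) p :=
  if k == 0 then - (N p / S p * (u1 p + 2 * u p * (u p - v p))) else v1 p.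

Definition static_christoffel (k i j : 'I_4) p : R :=
  (k == j)%:R * (kap k p * X p i) + (k == i)%:R * (kap k p * X p j)
  - (i == j)%:R * (tau i p * X p k).

Lemma is_derive_space_coord p c i :
  is_derive p (e_ c) (fun q => X q i) ((c == i) && (i != 0))%:R.
Proof.
rewrite /space_coord; case: eqVneq => [->|i0].
  by rewrite andbF; exact: is_derive_const.
by rewrite andbT; exact: is_derive_entry.
Qed.

Let dkap p c k : M p -> is_derive p (e_ c) (kap k) (kap1 k p * X p c).
Proof. by move=> Mp; rewrite /kap /kap1; case: eqP => _; [exact: du|exact: dv]. Qed.

Let dtau p c k : M p -> is_derive p (e_ c) (tau k) (tau1 k p * X p c).
Proof.
move=> Mp; rewrite /tau /tau1; case: eqP => _; last exact: dv.
apply: is_derive_eq.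
  apply: is_derive_opp; apply: is_derive_mul; last exact: du.
  by apply: is_derive_div; [exact: S0|exact: dN|exact: dS].
by rewrite /=; field; exact: S0.
Qed.

Let static_christoffel1 (c k i j : 'I_4) p : R :=
  (k == j)%:R * (kap k p * ((c == i) && (i != 0))%:R + X p i * (kap1 k p * X p c))
  + (k == i)%:R * (kap k p * ((c == j) && (j != 0))%:R + X p j * (kap1 k p * X p c))
  - (i == j)%:R * (tau i p * ((c == k) && (k != 0))%:R + X p k * (tau1 i p * X p c)).

Let d_static_christoffel p c k i j : M p ->
  is_derive p (e_ c) (static_christoffel k i j) (static_christoffel1 c k i j p).
Proof.
move=> Mp; apply: is_derive_sub; first apply: is_derive_add.
all: apply: is_derive_mull; apply: is_derive_mul; rewrite ?X; try exact: is_derive_space_coord.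
all: by [exact: dkap|exact: dtau].
Qed.

Lemma inv_static_metric p i j : M p ->
  inv_metric g i j p = ((if i == 0 then - (N p)^-1 else (S p)^-1) *+ (i == j)).
Proof.
move=> Mp; rewrite /inv_metric gE // invmx_diag.
  by rewrite !mxE; move: i; apply: ord4_ind => /=; rewrite ?invrN.
by apply: ord4_ind; rewrite row4E ?oppr_eq0 ?N0 ?S0.
Qed.

Let gd (l : 'I_4) p := if l == 0 then - N p else S p.

Let partial_g p i l j : M p ->
  partial i (fun q => g q l j) p = (2 * gd l p * kap l p * X p i) * (l == j)%:R.
Proof.
move=> Mp; rewrite /partial.
rewrite (@near_eq_derive _ _ _ _ (fun q => (l == j)%:R * gd l q)); last first.
  near=> q; rewrite gE; last by near: q; exact: M_near.
  rewrite !mxE /gd mulr_natl; congr (_ *+ _).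
  by move: l; apply: ord4_ind.
rewrite mulrC; apply: partialP; apply: is_derive_mull.
rewrite /gd /kap; case: eqP => _; last exact: dS.
by apply: is_derive_eq; [apply: is_derive_opp; exact: dN|ring].
Unshelve. all: by end_near. Qed.

Lemma christoffel_static p k i j : M p ->
  christoffel g k i j p = static_christoffel k i j p.
Proof.
move=> Mp; rewrite /christoffel sum_ord4 !partial_g // !inv_static_metric //.
rewrite /static_christoffel /gd /kap /tau /space_coord.
move: (N0 Mp) (S0 Mp) => Np0 Sp0.
by move: k i j; do 3!apply: ord4_ind; rewrite /= ?mulr1n ?mulr0n; field; rewrite ?Np0 ?Sp0.
Qed.

Let q2 p := X p 1 ^+ 2 + X p 2 ^+ 2 + X p 3 ^+ 2.

(** Rotational symmetry leaves the spatial Ricci tensor only the two parts delta_ij and x_i x_j,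
    with coefficients [Ric1] and [Ric2]; [Ric0] is the time component, and time-space components
    vanish. *)
Let Ric0 p := N p / S p * (u1 p * q2 p + 3 * u p + (u p ^+ 2 + u p * v p) * q2 p).
Let Ric1 p :=
  - (4 * v p + v1 p * q2 p + v p ^+ 2 * q2 p + u p + u p * v p * q2 p).
Let Ric2 p := v p ^+ 2 - v1 p - u1 p - u p ^+ 2 + 2 * u p * v p.

Lemma ricci_static p b d : M p ->
  ricci g b d p = (b == d)%:R * (if b == 0 then Ric0 p else Ric1 p)
                  + X p b * X p d * Ric2 p.
Proof.
move=> Mp.
have dG c k i j : partial c (christoffel g k i j) p = static_christoffel1 c k i j p.
  rewrite /partial; rewrite (@near_eq_derive _ _ _ _ (static_christoffel k i j)).
    by apply: partialP; exact: d_static_christoffel.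
  by near=> q; apply: christoffel_static; near: q; exact: M_near.
rewrite /ricci /riemann !sum_ord4 !dG !christoffel_static //.
rewrite /static_christoffel /static_christoffel1 /Ric0 /Ric1 /Ric2 /q2.
rewrite /kap /tau /kap1 /tau1 /space_coord.
move: (N0 Mp) (S0 Mp) => Np0 Sp0.
by move: b d; do 2!apply: ord4_ind; rewrite /=; field; rewrite ?Np0 ?Sp0.
Unshelve. all: by end_near. Qed.

Lemma einstein_static p mu nu : M p ->
  einstein g mu nu p = ((mu == nu)%:R *
      (if mu == 0 then 6 * v p + 2 * v1 p * q2 p + v p ^+ 2 * q2 p
       else 2 * u p + 2 * v p + (u1 p + v1 p + u p ^+ 2) * q2 p)
    + X p mu * X p nu * Ric2 p) / S p.
Proof.
move=> Mp; rewrite /einstein /scalar_curvature /ricci_mixed.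
rewrite !sum_ord4 !inv_static_metric // !ricci_static //.
rewrite /Ric0 /Ric1 /Ric2 /q2 /space_coord.
move: (N0 Mp) (S0 Mp) => Np0 Sp0.
by move: mu nu; do 2!apply: ord4_ind; rewrite /= ?mulr1n ?mulr0n; field; rewrite ?Np0 ?Sp0.
Qed.

End StaticMetric.

(** * The spherical chart, its Jacobian and its range *)

Section SphericalChart.
Context {R : realType}.
Implicit Types (p q : 'rV[R]_4).

Lemma spherical_chart_differentiable q : differentiable (spherical_chart id) q.
Proof.
have dsin (x : R) : differentiable sin x by apply/derivable1_diffP.
have dcos (x : R) : differentiable cos x by apply/derivable1_diffP.
have dq j : differentiable (fun p : 'rV[R]_4 => p 0 j) q by exact: differentiable_coord.
have ds j : differentiable (fun p : 'rV[R]_4 => sin (p 0 j)) q.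
  exact: (differentiable_comp (dq j) (dsin _)).
have dc j : differentiable (fun p : 'rV[R]_4 => cos (p 0 j)) q.
  exact: (differentiable_comp (dq j) (dcos _)).
rewrite (_ : spherical_chart id = fun p => \sum_j (spherical_chart id p 0 j) *: delta_mx 0 j).
  rewrite (_ : (fun _ => _) = \sum_j (fun p : 'rV[R]_4 =>
    (spherical_chart id p 0 j) *: delta_mx 0 j)); last first.
    by apply/funext => p; rewrite fct_sumE.
  apply: differentiable_sum => j; apply: differentiableZl.
  move: j; apply: ord4_ind; rewrite /spherical_chart;
    under eq_fun do rewrite row4E.
  - exact: dq.
  - exact: differentiableM (dq 1) (differentiableM (ds 2) (dc 3)).
  - exact: differentiableM (dq 1) (differentiableM (ds 2) (ds 3)).
  - exact: differentiableM (dq 1) (dc 2).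
by apply/funext => p; exact: row_sum_delta.
Qed.

(** The two difference quotients are equal. This moves directional derivatives to one variable, both
    for the chain rule that follows and for integration along coordinate lines. *)
Lemma is_derive_line (V : normedModType R) (f : V -> R) x w (a s : R) :
  is_derive (s *: w + x) w f a <-> is_derive s 1 (fun h => f (h *: w + x)) a.
Proof.
have E : (fun h : R => h^-1 *: (f (h *: w + (s *: w + x)) - f (s *: w + x))) =
         (fun h : R => h^-1 *: (f ((h *: 1 + s) *: w + x) - f (s *: w + x))).
  by apply/funext => h; rewrite scalerDl addrA [h *: 1]mulr1.
by split=> [[df <-]|[df <-]]; split; rewrite /derivable /derive in df *;
  move: df; rewrite /= E.
Qed.

Lemma is_derive_comp1 (V : normedModType R) (f : R -> R) (g : V -> R) x w (a b : R) :
  is_derive (g x) 1 f a -> is_derive x w g b -> is_derive x w (f \o g) (a * b).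
Proof.
have := is_derive_line g x w b 0; rewrite scale0r add0r => lineg.
have := is_derive_line (f \o g) x w (a * b) 0; rewrite scale0r add0r => linefg.
move=> df /lineg dg; apply/linefg.
apply: (@is_derive1_comp _ f (fun h => g (h *: w + x))) => //.
by rewrite scale0r add0r.
Qed.

Lemma spherical_jacobian q i j : 'J (spherical_chart id) q i j =
  nth 0 (nth [::] [:: [:: 1; 0; 0; 0];
    [:: 0; sin (q 0 2) * cos (q 0 3); sin (q 0 2) * sin (q 0 3); cos (q 0 2)];
    [:: 0; q 0 1 * (cos (q 0 2) * cos (q 0 3)); q 0 1 * (cos (q 0 2) * sin (q 0 3));
       - (q 0 1 * sin (q 0 2))];
    [:: 0; - (q 0 1 * (sin (q 0 2) * sin (q 0 3))); q 0 1 * (sin (q 0 2) * cos (q 0 3));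
       0]] i) j.
Proof.
have dF := spherical_chart_differentiable q.
have -> : 'J (spherical_chart id) q i j = 'D_(delta_mx 0 i) (spherical_chart id) q 0 j.
  by rewrite deriveEjacobian // -rowE [RHS]mxE.
rewrite derive_mx ?mxE; last exact: diff_derivable.
have dc k l : is_derive q (delta_mx 0 k) (fun p : 'rV[R]_4 => cos (p 0 l))
    (- sin (q 0 l) * (k == l)%:R).
  exact: is_derive_comp1 (is_derive_cos _) (is_derive_entry _ _ _).
have ds k l : is_derive q (delta_mx 0 k) (fun p : 'rV[R]_4 => sin (p 0 l))
    (cos (q 0 l) * (k == l)%:R).
  exact: is_derive_comp1 (is_derive_sin _) (is_derive_entry _ _ _).
rewrite /spherical_chart; move: j; apply: ord4_ind; under eq_fun do rewrite row4E.
- by rewrite [LHS](partialP (is_derive_entry _ _ _)); move: i; apply: ord4_ind; rewrite /=.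
- rewrite [LHS](partialP (is_derive_mul (is_derive_entry _ _ _) (is_derive_mul (ds _ _) (dc _ _)))).
  by move: i; apply: ord4_ind; rewrite /=; ring.
- rewrite [LHS](partialP (is_derive_mul (is_derive_entry _ _ _) (is_derive_mul (ds _ _) (ds _ _)))).
  by move: i; apply: ord4_ind; rewrite /=; ring.
- rewrite [LHS](partialP (is_derive_mul (is_derive_entry _ _ _) (dc _ _))).
  by move: i; apply: ord4_ind; rewrite /=; ring.
Qed.


Lemma spherical_diag q (a b : R) :
  'J (spherical_chart id) q *m diag_mx (row4 a b b b) *m ('J (spherical_chart id) q)^T
  = diag_mx (row4 a b (b * q 0 1 ^+ 2) (b * (q 0 1 ^+ 2 * sin (q 0 2) ^+ 2))).
Proof.
have c2 : cos (q 0 2) ^+ 2 = 1 - sin (q 0 2) ^+ 2 by exact: cos2sin2.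
have c3 : cos (q 0 3) ^+ 2 = 1 - sin (q 0 3) ^+ 2 by exact: cos2sin2.
move: (spherical_jacobian q); move: ('J _ q) => J JE.
apply/matrixP => i j; rewrite mul_mx_diag mxE sum_ord4 !mxE !JE.
move: (q 0 1) c2 c3 => r.
move: (sin (q 0 2)) (cos (q 0 2)) (sin (q 0 3)) (cos (q 0 3)) => st ct sp cp c2 c3.
move: i j; do 2!apply: ord4_ind; rewrite /= ?mulr1n ?mulr0n; try ring.
- transitivity (b * (st ^+ 2 * (cp ^+ 2 + sp ^+ 2) + ct ^+ 2)); first by ring.
  by rewrite c2 c3; ring.
- transitivity (b * r * st * ct * (cp ^+ 2 + sp ^+ 2 - 1)); first by ring.
  by rewrite c3; ring.
- transitivity (b * r * st * ct * (cp ^+ 2 + sp ^+ 2 - 1)); first by ring.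
  by rewrite c3; ring.
- transitivity (b * r ^+ 2 * (ct ^+ 2 * (cp ^+ 2 + sp ^+ 2) + st ^+ 2)); first by ring.
  by rewrite c2 c3; ring.
- transitivity (b * r ^+ 2 * st ^+ 2 * (cp ^+ 2 + sp ^+ 2)); first by ring.
  by rewrite c3; ring.
Qed.

(** Invertibility of the Jacobian J is read off from J J^T, the flat metric in spherical
    coordinates: it is diagonal, with nonzero entries off the axis. *)
Lemma spherical_pullback_inj q (g h : 'rV[R]_4 -> 'M[R]_4) :
  q 0 1 != 0 -> sin (q 0 2) != 0 ->
  pullback g (spherical_chart id) q = pullback h (spherical_chart id) q ->
  g (spherical_chart id q) = h (spherical_chart id q).
Proof.
move=> q1 q2 gh; set J := 'J (spherical_chart id) q.
have JJ : J *m J^T = diag_mx (row4 1 1 (q 0 1 ^+ 2) (q 0 1 ^+ 2 * sin (q 0 2) ^+ 2)).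
  have := spherical_diag q 1 1; rewrite !mul1r => <-; congr (_ *m _).
  rewrite (_ : row4 _ _ _ _ = const_mx 1) ?diag_const_mx ?mulmx1 //.
  by apply/rowP; apply: ord4_ind; rewrite row4E mxE.
have : J *m J^T \in unitmx.
  rewrite JJ unitmxE det_diag unitfE; apply/prodf_neq0 => i _.
  by move: i; apply: ord4_ind; rewrite row4E ?oner_neq0 ?mulf_neq0 ?expf_neq0.
rewrite unitmx_mul => /andP[uJ uJt].
move: gh; rewrite /pullback -/J => /(can_inj (mulmxK uJt)).
by move=> /(can_inj (mulKmx uJ)).
Qed.

Lemma rho_of_gt0 p : 0 < p 0 1 ^+ 2 + p 0 2 ^+ 2 -> 0 < rho_of p.
Proof. by move=> p0; rewrite sqrtr_gt0 ltr_wpDr ?sqr_ge0. Qed.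

Lemma polar_coordinates (x y : R) : 0 < x ^+ 2 + y ^+ 2 ->
  exists phi, x = Num.sqrt (x ^+ 2 + y ^+ 2) * cos phi /\
              y = Num.sqrt (x ^+ 2 + y ^+ 2) * sin phi.
Proof.
move=> s0; set s := Num.sqrt _.
have sp : 0 < s by rewrite sqrtr_gt0.
have s2 : s ^+ 2 = x ^+ 2 + y ^+ 2 by rewrite sqr_sqrtr // ltW.
have xs : -1 <= x / s <= 1.
  rewrite -ler_norml normrM normfV (gtr0_norm sp) ler_pdivrMr // mul1r.
  by rewrite -(gtr0_norm sp) -ler_sqr ?nnegrE // ?real_normK ?num_real // s2 lerDl sqr_ge0.
have cosE : x = s * cos (acos (x / s)) by rewrite acosK // mulrC divfK ?gt_eqF.
have sinE : s * sin (acos (x / s)) = `|y|.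
  rewrite sin_acos // -{1}(gtr0_norm sp) -sqrtr_sqr -sqrtrM ?sqr_ge0 //.
  rewrite -[RHS]sqrtr_sqr; congr Num.sqrt.
  rewrite mulrBr mulr1 expr_div_n mulrC divfK ?sqrf_eq0 ?gt_eqF // s2.
  by rewrite addrC addKr.
(* [acos] takes values in [0, pi], where the sine is nonnegative; the opposite angle serves for y <
   0. *)
have [y0|y0] := leP 0 y; first by exists (acos (x / s)); rewrite sinE ger0_norm.
by exists (- acos (x / s)); rewrite cosN sinN mulrN sinE ltr0_norm ?opprK.
Qed.

Lemma spherical_coordinates p : 0 < p 0 1 ^+ 2 + p 0 2 ^+ 2 ->
  exists theta phi, 0 < theta < pi /\
    p = spherical_chart id (row4 (p 0 0) (rho_of p) theta phi).
Proof.
move=> s0; have r0 := rho_of_gt0 s0; set r := rho_of p in r0 *.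
set s := Num.sqrt (p 0 1 ^+ 2 + p 0 2 ^+ 2).
have sp : 0 < s by rewrite sqrtr_gt0.
have r2 : r ^+ 2 = s ^+ 2 + p 0 3 ^+ 2.
  by rewrite !sqr_sqrtr ?addr_ge0 ?sqr_ge0.
(* Strict because the point is off the axis; hence theta avoids 0 and pi. *)
have zr : -1 < p 0 3 / r < 1.
  rewrite -ltr_norml normrM normfV (gtr0_norm r0) ltr_pdivrMr // mul1r.
  rewrite -(gtr0_norm r0) -ltr_sqr ?nnegrE // ?real_normK ?num_real // r2.
  by rewrite ltrDr exprn_gt0.
have zr1 : -1 <= p 0 3 / r <= 1 by case/andP: zr => *; rewrite !ltW.
have [phi [xE yE]] := polar_coordinates s0; rewrite -/s in xE yE.
exists (acos (p 0 3 / r)), phi; split.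
  by case/andP: zr => lo hi; rewrite acos_gt0 ?acos_ltpi ?lo ?hi ?ltW.
have sinE : r * sin (acos (p 0 3 / r)) = s.
  rewrite sin_acos // -{1}(gtr0_norm r0) -sqrtr_sqr -sqrtrM ?sqr_ge0 //.
  rewrite -[RHS](gtr0_norm sp) -sqrtr_sqr; congr Num.sqrt.
  rewrite mulrBr mulr1 expr_div_n mulrC divfK ?sqrf_eq0 ?gt_eqF // r2.
  by rewrite addrK.
apply/rowP; apply: ord4_ind; rewrite /spherical_chart !row4E /= ?mulrA ?sinE //.
by rewrite acosK // mulrC divfK ?gt_eqF.
Qed.

End SphericalChart.

(** * From the spherical line element to Cartesian components *)

Section MetricInCartesianCoordinates.
Context {R : realType}.
Implicit Types (p q : 'rV[R]_4).

Lemma rho_of_sqr p : rho_of p ^+ 2 = p 0 1 ^+ 2 + p 0 2 ^+ 2 + p 0 3 ^+ 2.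
Proof. by rewrite sqr_sqrtr // !addr_ge0 ?sqr_ge0. Qed.

Lemma rho_of_spherical_chart q : 0 < q 0 1 ->
  rho_of (spherical_chart id q) = q 0 1.
Proof.
move=> q0; have c2 : cos (q 0 2) ^+ 2 = 1 - sin (q 0 2) ^+ 2 by exact: cos2sin2.
have c3 : cos (q 0 3) ^+ 2 = 1 - sin (q 0 3) ^+ 2 by exact: cos2sin2.
rewrite /rho_of /spherical_chart !row4E -[RHS]gtr0_norm // -sqrtr_sqr.
by congr Num.sqrt; rewrite !exprMn c2 c3; ring.
Qed.

Lemma rho_of_continuous : continuous (@rho_of R).
Proof.
move=> p; rewrite /rho_of; apply: (@continuous_comp _ _ _ (fun p : 'rV[R]_4 =>
  p 0 1 ^+ 2 + p 0 2 ^+ 2 + p 0 3 ^+ 2) Num.sqrt); last exact: sqrt_continuous.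
have c2 i : {for p, continuous (fun p : 'rV[R]_4 => p 0 i ^+ 2)}.
  by apply: (@continuousM _ _ (fun p : 'rV[R]_4 => p 0 i) (fun p => p 0 i));
    exact: coord_continuous.
by apply: continuousD => //; apply: continuousD.
Qed.

Lemma open_spacetime (rho0 : R) : open (spacetime rho0).
Proof.
apply: (@open_comp _ _ (@rho_of R) [set x | rho0 < x]); last exact: open_gt.
by move=> p _; exact: rho_of_continuous.
Qed.

Lemma near_spacetime (rho0 : R) p : rho0 < rho_of p -> \near p, rho0 < rho_of p.
Proof.
move=> pM; have : open_nbhs p (spacetime rho0).
  by split => //; exact: open_spacetime.
exact: open_nbhs_nbhs.
Qed.

(** Off the axis the pullback determines [g], and the diagonal matrix [h] has the same pullback. On
    the axis both sides are continuous, so equality extends by a limit. *)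
Lemma conformally_flat_metric (c rho0 : R) (gamma phi N S : R -> R)
    (g : 'rV[R]_4 -> 'M[R]_4) :
  0 < rho0 ->
  (forall p, rho0 < rho_of p -> forall i j, {for p, continuous (fun q => g q i j)}) ->
  conformally_flat_form c rho0 gamma phi g ->
  (forall x, rho0 < x -> N x = expR (2 * gamma x) * c ^+ 2) ->
  (forall x, rho0 < x -> S x = phi x ^+ 4) ->
  (forall x, rho0 < x -> {for x, continuous N} /\ {for x, continuous S}) ->
  forall p, rho0 < rho_of p -> g p = diag_mx (row4 (- N (rho_of p))
    (S (rho_of p)) (S (rho_of p)) (S (rho_of p))).
Proof.
move=> rho00 gcont gE NE SE NScont.
pose h p : 'M[R]_4 := diag_mx (row4 (- N (rho_of p))
    (S (rho_of p)) (S (rho_of p)) (S (rho_of p))).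
have off_axis p : rho0 < rho_of p -> 0 < p 0 1 ^+ 2 + p 0 2 ^+ 2 -> g p = h p.
  move=> pM /spherical_coordinates[theta [phi' [th pE]]].
  have rp : 0 < rho_of p by exact: lt_trans pM.
  rewrite {1 2}pE; apply: spherical_pullback_inj; rewrite ?row4E ?gt_eqF ?sin_gt0_pi //.
  rewrite gE // /pullback [h _](_ : _ = diag_mx (row4 (- N (rho_of p))
    (S (rho_of p)) (S (rho_of p)) (S (rho_of p)))) ?spherical_diag ?row4E ?NE ?SE //.
    by rewrite -mulNr.
  by rewrite /h -pE NE ?SE.
have hcont p : rho0 < rho_of p -> forall i j, {for p, continuous (fun q => h q i j)}.
  move=> pM i j; have [Nc Sc] := NScont _ pM.
  have cN : {for p, continuous (N \o @rho_of R)}.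
    by apply: continuous_comp; [exact: rho_of_continuous|exact: Nc].
  have cS : {for p, continuous (S \o @rho_of R)}.
    by apply: continuous_comp; [exact: rho_of_continuous|exact: Sc].
  have -> : (fun q => h q i j) = fun q =>
      (i == j)%:R * row4 (- N (rho_of q)) (S (rho_of q)) (S (rho_of q)) (S (rho_of q)) 0 i.
    by apply/funext => q; rewrite /h mxE mulr_natl; have [->|] := eqVneq i j.
  apply: continuousM; first exact: cst_continuous.
  move: i; apply: ord4_ind.
  - rewrite (_ : (fun _ => _) = - (N \o @rho_of R)); first exact: continuousN.
    by apply/funext => q; rewrite row4E.
  - by rewrite (_ : (fun _ => _) = S \o @rho_of R) //; apply/funext => q; rewrite row4E.
  - by rewrite (_ : (fun _ => _) = S \o @rho_of R) //; apply/funext => q; rewrite row4E.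
  - by rewrite (_ : (fun _ => _) = S \o @rho_of R) //; apply/funext => q; rewrite row4E.
move=> p pM; have [/off_axis->//|] := ltP 0 (p 0 1 ^+ 2 + p 0 2 ^+ 2).
rewrite le_eqVlt ltNge addr_ge0 ?sqr_ge0 // orbF paddr_eq0 ?sqr_ge0 // !sqrf_eq0.
move=> /andP[/eqP p1 /eqP p2]; apply/matrixP => i j.
(* The line leaves the axis in the x1 direction, so [g] and [h] agree on it for small s different
   from 0. *)
pose line (s : R) := s *: delta_mx 0 1 + p : 'rV[R]_4.
have line0 : line 0 = p by rewrite /line scale0r add0r.
have line_cont : {for 0, continuous line}.
  by apply: continuousD; [exact: scalel_continuous|exact: cst_continuous].
have lineM : \forall s \near (0 : R), rho0 < rho_of (line s).
  have lc : line @ 0 --> p by rewrite -[X in _ --> X]line0; exact: line_cont.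
  exact: lc _ (near_spacetime pM).
pose d s := g (line s) i j - h (line s) i j.
have dcont : d s @[s --> 0^'] --> d 0.
  apply: cvg_within_filter; apply: continuousB.
    by apply: (@continuous_comp _ _ _ line (fun q => g q i j)); rewrite ?line0 //; exact: gcont.
  by apply: (@continuous_comp _ _ _ line (fun q => h q i j)); rewrite ?line0 //; exact: hcont.
have d0 : d s @[s --> 0^'] --> (0 : R).
  apply: cvg_near_cst; near=> s.
  have s0 : s != 0 by near: s; exact: nbhs_dnbhs_neq.
  have sM : rho0 < rho_of (line s) by near: s; exact: nbhs_dnbhs lineM.
  rewrite /d off_axis ?subrr //.
  by rewrite /line !mxE /= p1 p2 !(mulr0, mulr1, addr0) expr0n /= addr0 exprn_even_gt0.
have : d 0 = 0 by exact: (cvg_unique (@Rhausdorff R) dcont d0).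
by rewrite /d line0 => /eqP; rewrite subr_eq0 => /eqP.
Unshelve. all: by end_near. Qed.

End MetricInCartesianCoordinates.

(** * The mass function and the conformal radius *)

Section PowerSeries.
Context {R : realType}.
Implicit Types (c : R^nat) (x y z r : R).

(** After division by y - z, this compares n + 1 copies of z^n with the sum of the y^i z^(n-i). It
    absorbs the factor n + 1 that differentiation puts into a power series. *)
Lemma mulrn_exp_le_subX z y n : 0 <= z -> z <= y ->
  n.+1%:R * z ^+ n * (y - z) <= y ^+ n.+1 - z ^+ n.+1.
Proof.
move=> z0 zy; elim: n => [|n IH]; first by rewrite mul1r expr0 mul1r !expr1.
have -> : n.+2%:R * z ^+ n.+1 * (y - z) =
    z * (n.+1%:R * z ^+ n * (y - z)) + z ^+ n.+1 * (y - z).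
  by rewrite -(natr1 n.+1) exprS; ring.
have zy1 : 0 <= (y - z) * (y ^+ n.+1 - z ^+ n.+1).
  by rewrite mulr_ge0 ?subr_ge0 // lerXn2r ?nnegrE // (le_trans z0).
have := ler_wpM2l z0 IH; rewrite !(exprS _ n.+1) => ?.
by rewrite -subr_ge0; move: zy1; rewrite -subr_ge0; nra.
Qed.

Lemma is_cvg_pseries_diffs c x z : cvgn (pseries c x) -> `|z| < `|x| ->
  cvgn (pseries (pseries_diffs c) z).
Proof.
(* An intermediate radius: the original series converges absolutely at y, and the gap y - |z| pays
   for the factor n + 1. *)
move=> cx zx; pose y := (`|z| + `|x|) / 2.
have [zy yx] : `|z| < y /\ y < `|x| by rewrite /y; split; lra.
have y0 : 0 <= y by rewrite (le_trans _ (ltW zy)).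
have /(is_cvg_pseries_inside_norm cx) cy : `|y| < `|x| by rewrite ger0_norm.
apply: normed_cvg.
have cyS : cvgn (series (fun n => (y - `|z|)^-1 * (`|c n.+1| * y ^+ n.+1))).
  apply: (@is_cvg_seriesZ _ (fun n => `|c n.+1| * y ^+ n.+1)).
  move/cvg_ex : cy => [l cy]; apply/cvg_ex; exists (l - `|c 0%N| * y ^+ 0).
  rewrite (_ : series _ = (fun n => series (fun n => `|c n| * y ^+ n) n.+1 - `|c 0%N| * y ^+ 0)).
    by apply: cvgB; [rewrite cvg_shiftS; exact: cy|exact: cvg_cst].
  by apply/funext => n; rewrite /series /= big_nat_recl // addrC addKr.
apply: (series_le_cvg _ _ _ cyS) => n; first exact: normr_ge0.
  by rewrite !mulr_ge0 ?invr_ge0 ?subr_ge0 ?exprn_ge0 // ltW.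
rewrite /= /pseries_diffs !normrM normr_nat normrX [leRHS]mulrC.
rewrite ler_pdivlMr ?subr_gt0 // (mulrC _%:R) -2!mulrA ler_wpM2l // mulrA.
rewrite (le_trans (mulrn_exp_le_subX n (normr_ge0 z) (ltW zy))) //.
by rewrite lerBlDr lerDl exprn_ge0.
Qed.

Lemma is_cvg_pseries_iter_diffs c (d : R) i :
  (forall x, 0 < x < d -> cvgn (pseries c x)) ->
  forall x, 0 < x < d -> cvgn (pseries (iter i (@pseries_diffs R) c) x).
Proof.
move=> cd; elim: i => [//|i IH] x /andP[x0 xd].
have [xy yd] : x < (x + d) / 2 /\ (x + d) / 2 < d by split; lra.
have y0 : 0 < (x + d) / 2 by lra.
by apply: (@is_cvg_pseries_diffs _ ((x + d) / 2)); [apply: IH; rewrite y0|rewrite !gtr0_norm].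
Qed.

Lemma is_derive_pseries_iter c (d : R) i x :
  (forall x, 0 < x < d -> cvgn (pseries c x)) -> `|x| < d ->
  is_derive x 1 (fun x => limn (pseries (iter i (@pseries_diffs R) c) x))
                (limn (pseries (iter i.+1 (@pseries_diffs R) c) x)).
Proof.
move=> cd xd.
have [xy yd] : `|x| < (`|x| + d) / 2 /\ (`|x| + d) / 2 < d by split; lra.
have y0 : 0 < (`|x| + d) / 2 by have := normr_ge0 x; lra.
apply: (@pseries_snd_diffs _ _ ((`|x| + d) / 2)); rewrite ?(gtr0_norm y0) //.
- by apply: is_cvg_pseries_iter_diffs cd _ _; rewrite y0.
- by apply: (is_cvg_pseries_iter_diffs (i := i.+1) cd); rewrite y0.
- by apply: (is_cvg_pseries_iter_diffs (i := i.+2) cd); rewrite y0.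
Qed.

Lemma derive1n_pseries (m : R -> R) c (d : R) i :
  (forall r, 0 < r < d -> cvgn (pseries c r)) ->
  (forall r, 0 < r < d -> m r = limn (pseries c r)) ->
  forall r, 0 < r < d ->
    (m^`(i))%classic r = limn (pseries (iter i (@pseries_diffs R) c) r).
Proof.
move=> cd mE; elim: i => [//|i IH] r /[dup] rd /andP[r0 rd'].
have rd1 : `|r| < d by rewrite gtr0_norm.
rewrite derive1nS derive1E.
have [_ <-] := is_derive_pseries_iter i cd rd1.
apply: near_eq_derive; near=> s; apply: IH.
by near: s; apply: (near_in_itvoo (a := 0) (b := d)); rewrite in_itv.
Unshelve. all: by end_near. Qed.

(** Nothing is known of [m] at or below 0, so the bound comes from the sum of the termwise
    differentiated series: it is continuous at 0 and coincides with the derivative of [m] to the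
    right of 0. *)
Lemma power_series_derive1n_bounded (m : R -> R) c i : abs_power_series_at0 m c ->
  exists C, \forall r \near 0^'+, `|(m^`(i))%classic r| <= C.
Proof.
case=> d d0 mc.
have cd r : 0 < r < d -> cvgn (pseries c r).
  by move=> /mc[_ mr]; apply/cvg_ex; exists (m r).
have mE r : 0 < r < d -> m r = limn (pseries c r).
  by move=> /mc[_ mr]; apply/esym/cvg_lim => //; exact: Rhausdorff.
pose h r := limn (pseries (iter i (@pseries_diffs R) c) r).
have hc : {for 0, continuous h}.
  apply: differentiable_continuous; apply/derivable1_diffP.
  by have [] : is_derive (0 : R) (1 : R) h (limn (pseries (iter i.+1 (@pseries_diffs R) c) 0));
    [apply: is_derive_pseries_iter cd _; rewrite normr0|].
exists (`|h 0| + 1); near=> r.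
have r0 : 0 < r by [].
rewrite (derive1n_pseries i cd mE); last by rewrite r0 /=; near: r; exact: nbhs_right_lt.
have : `|h 0 - h r| < 1.
  near: r; apply: cvg_within; move/cvgrPdist_lt : hc; exact.
by rewrite -/(h r) distrC => hr; have := lerB_dist (h r) (h 0); lra.
Unshelve. all: by end_near. Qed.

Lemma continuous_pos_bounded (h : R -> R) :
  (forall r, 0 < r -> {for r, continuous h}) ->
  (exists C, \forall r \near 0^'+, `|h r| <= C) ->
  forall r1, exists2 C, 0 <= C & forall r, 0 < r <= r1 -> `|h r| <= C.
Proof.
move=> hc [C [e /= e0 hC]] r1.
(* The maximum keeps [e/2, b] nonempty when r1 is small or negative. *)
pose b := Num.max r1 e.
have eb : e / 2 < b by rewrite lt_max; apply/orP; right; lra.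
have hw : {within `[e / 2, b], continuous (fun r => `|h r|)}.
  apply: continuous_in_subspaceT => r; rewrite inE /= in_itv /= => /andP[er _].
  by apply: continuous_comp; [apply: hc; lra|exact: norm_continuous].
have [s _ sP] := EVT_max (ltW eb) hw.
exists (Num.max `|C| `|h s|); first by rewrite le_max normr_ge0.
move=> r /andP[r0 rr1]; rewrite le_max; apply/orP.
have [re|er] := ltP r e.
  left; apply: le_trans (ler_norm C); apply: hC => //=.
  by rewrite sub0r normrN gtr0_norm.
by right; apply: sP; rewrite in_itv /= le_max rr1 andbT; lra.
Qed.

End PowerSeries.

(** Positivity of I encodes integrability: the real-valued integral takes the value 0 when the
    extended one is infinite, so 0 < I r excludes divergence at 0. The derivative is then the
    fundamental theorem of calculus. *)
Lemma is_derive_integral_pos (R : realType) (w : R -> R) :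
  let I (r : R) := (\int[lebesgue_measure]_(s in `]0%R, r[) w s)%R in
  (forall s, 0 < s -> {for s, continuous w}) -> (forall s, 0 <= w s) ->
  (forall r, 0 < r -> 0 < I r) ->
  forall r : R, 0 < r -> is_derive r 1 I (w r).
Proof.
move=> I wc w0 I0.
have int r : 0 < r -> lebesgue_measure.-integrable `]0%R, r[ (EFin \o w).
  move=> r0; apply/integrableP; split.
    apply/measurable_EFinP.
    apply: open_continuous_measurable_fun; first exact: interval_open.
    by move=> s; rewrite inE /= in_itv /= => /andP[s0 _]; exact: wc.
  under eq_integral do rewrite /= ger0_norm //.
  rewrite ltNge leye_eq; apply/eqP => oo.
  by have := I0 _ r0; rewrite /I /Rintegral oo /= ltxx.
have intc r : 0 < r -> lebesgue_measure.-integrable `]0%R, r] (EFin \o w).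
  move=> r0; have r1 : 0 < r + 1 by lra.
  apply: (integrableS _ _ _ (int _ r1)) => //.
  by apply: subset_itvl; rewrite bnd_simp; lra.
move=> r r0; have r1 : 0 < r + 1 by lra.
have rr1 : r < r + 1 by lra.
have [dF F1] := continuous_FTC1 rr1 (intc _ r1) (r0 : (BRight 0 < BRight r)%O) (wc _ r0).
have : is_derive r (1 : R) (fun x => \int[lebesgue_measure]_(t in [set` `]0%R, x]]) w t)%R (w r).
  by split; [exact: dF|rewrite -derive1E; exact: F1].
apply: near_eq_is_derive; near=> x; have x0 : 0 < x by near: x; exact: lt_nbhsr.
by apply/esym/Rintegral_itv_bndo_bndc; exact: int.
Unshelve. all: by end_near. Qed.

(** * The conformal radius and its inverse *)

Section ConformalRadius.
Context {R : realType}.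
Variables (G c rho0 : R) (m rad : R -> R).
Local Notation k := (G / c ^+ 2).
Local Notation f := (conformal_radius G c rho0 m).
Local Notation dm i := (m^`(i))%classic.

Hypothesis rho0_gt0 : 0 < rho0.
Hypothesis m_smooth : smooth_on_pos m.
Hypothesis redshift_gt0 : forall r, 0 < r -> 0 < r ^+ 2 - 2 * k * r * m r.
Hypothesis rad_inv : radial_inverse rho0 f rad.

Lemma is_derive_derive1n i (r : R) : 0 < r -> is_derive r 1 (dm i) (dm i.+1 r).
Proof.
by move=> r0; split; [exact: m_smooth|rewrite derive1nS derive1E].
Qed.

Definition radial_root r := Num.sqrt (r ^+ 2 - 2 * k * r * m r).
Local Notation W := radial_root.

Lemma radial_root_gt0 r : 0 < r -> 0 < W r.
Proof. by move=> r0; rewrite sqrtr_gt0 redshift_gt0. Qed.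

Lemma radial_root_sqr r : 0 < r -> W r ^+ 2 = r ^+ 2 - 2 * k * r * m r.
Proof. by move=> r0; rewrite sqr_sqrtr // ltW // redshift_gt0. Qed.

Lemma is_derive_radial_root (r : R) : 0 < r ->
  is_derive r 1 W ((r - k * m r - k * r * dm 1 r) / W r).
Proof.
move=> r0; have W0 := radial_root_gt0 r0.
have dr : is_derive r (1 : R) (fun r => r ^+ 2 - 2 * k * r * m r)
    (2 * (r - k * m r - k * r * dm 1 r)).
  have id1 : is_derive r (1 : R) (fun s : R => s) 1 by exact: is_derive_id.
  have d2 := is_derive_sqr id1.
  have dk := is_derive_mul (is_derive_mull (2 * k) id1) (is_derive_derive1n 0 r0).
  apply: is_derive_eq (is_derive_sub d2 dk) _.
  by rewrite /=; ring.
have dW := @is_derive_comp1 R R Num.sqrt _ r 1 _ _ (is_derive1_sqrt (redshift_gt0 r0)) dr.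
apply: is_derive_eq dW _.
by rewrite -/(W r); move: k => K; field; rewrite gt_eqF.
Qed.

Lemma is_derive_conformal_radius (r : R) : 0 < r -> is_derive r 1 f (f r / W r).
Proof.
pose I r := (\int[lebesgue_measure]_(s in `]0%R, r[) (W s)^-1)%R.
have fE : f = fun r => rho0 * expR (I r).
  apply/funext => s; rewrite /conformal_radius; congr (_ * expR _).
  by apply: eq_Rintegral => x _; rewrite /radial_root !mulrA.
have Wc s : 0 < s -> {for s, continuous (fun s => (W s)^-1)}.
  move=> s0; apply: differentiable_continuous; apply/derivable1_diffP.
  by case: (is_derive_inv (lt0r_neq0 (radial_root_gt0 s0)) (is_derive_radial_root s0)).
have W0 s : 0 <= (W s)^-1 by rewrite invr_ge0 sqrtr_ge0.
(* A positive exponent is what rho0 < f s means; through it the bijection onto (rho0, oo) makes the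
   improper integral finite. *)
have I0 s : 0 < s -> 0 < I s.
  move=> s0; have : rho0 < rho0 * expR (I s).
    by have [/(_ _ s0)[]] := rad_inv; rewrite fE.
  by rewrite (ltr_pMr _ rho0_gt0) -{1}expR0 ltr_expR; exact.
move=> r0; have dI := is_derive_integral_pos Wc W0 I0 r0.
have df := is_derive_mull rho0 (@is_derive_comp1 _ _ expR I r 1 _ _ (is_derive_expR _) dI).
by rewrite fE -mulrA; exact: df.
Qed.

Lemma conformal_radius_gt0 r : 0 < f r.
Proof. by rewrite mulr_gt0 // expR_gt0. Qed.

Lemma conformal_radius_lt r s : 0 < r -> r < s -> f r < f s.
Proof.
move=> r0 rs.
have df x : r <= x -> is_derive x 1 f (f x / W x).
  by move=> rx; apply: is_derive_conformal_radius; exact: lt_le_trans rx.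
apply: (@gtr0_derive1_lt_cc _ f r s); rewrite ?in_itv /= ?lexx ?ltW //.
- by move=> x; rewrite in_itv /= => /andP[/ltW/df[]].
- move=> x; rewrite in_itv /= => /andP[rx _].
  have [_] := df _ (ltW rx); rewrite derive1E => ->.
  by rewrite divr_gt0 ?conformal_radius_gt0 ?radial_root_gt0 // (lt_trans r0).
- apply: derivable_within_continuous => x; rewrite in_itv /= => /andP[/df[]] //.
Qed.

Lemma rad_gt0 x : rho0 < x -> 0 < rad x.
Proof. by case: rad_inv => _ h /h[]. Qed.

Lemma conformal_radiusK x : rho0 < x -> f (rad x) = x.
Proof. by case: rad_inv => _ h /h[]. Qed.

Lemma rad_lt x r : 0 < r -> rho0 < x -> x < f r -> rad x < r.
Proof.
move=> r0 x0; apply: contraTT; rewrite -!leNgt le_eqVlt => /predU1P[->|].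
  by rewrite conformal_radiusK.
by move=> /(conformal_radius_lt r0); rewrite conformal_radiusK // => /ltW.
Qed.

Lemma is_derive_rad (x : R) : rho0 < x -> is_derive x 1 rad (W (rad x) / x).
Proof.
move=> x0; have r0 := rad_gt0 x0; have W0 := radial_root_gt0 r0.
rewrite -{1}(conformal_radiusK x0); apply: is_derive_eq.
  apply: (is_derive_inverse _ _ (is_derive_conformal_radius r0)).
  - near=> s; case: rad_inv => + _; move=> /(_ s)[] //.
    by near: s; exact: lt_nbhsr.
  - near=> s; apply: differentiable_continuous; apply/derivable1_diffP.
    have s0 : 0 < s by near: s; exact: lt_nbhsr.
    by have [] := is_derive_conformal_radius s0.
  - by rewrite gt_eqF // divr_gt0 // conformal_radius_gt0.
by rewrite conformal_radiusK // invf_div.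
Unshelve. all: by end_near. Qed.

Lemma is_derive_comp_rad (h : R -> R) (a x : R) : rho0 < x ->
  is_derive (rad x) 1 h a -> is_derive x 1 (h \o rad) (a * (W (rad x) / x)).
Proof. by move=> x0 dh; exact: is_derive_comp1 dh (is_derive_rad x0). Qed.

(** The 1/W of dW/dr cancels against the W of dr/drho. Hence W is differentiable in rho with a
    bounded derivative up to the boundary, which its r-derivative need not have. *)
Lemma is_derive_radial_root_rad (x : R) : rho0 < x ->
  is_derive x 1 (W \o rad)
    ((rad x - k * m (rad x) - k * rad x * dm 1 (rad x)) / x).
Proof.
move=> x0; have r0 := rad_gt0 x0; have W0 := radial_root_gt0 r0.
apply: is_derive_eq (is_derive_comp_rad x0 (is_derive_radial_root r0)) _.
by move: k => K; field; rewrite !gt_eqF // (lt_trans rho0_gt0).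
Qed.

Lemma rad_cvg0 : rad x @[x --> rho0^'+] --> (0 : R).
Proof.
apply/cvgrPdist_lt => e e0.
have [/(_ _ e0)[fe _] _] := rad_inv.
near=> x; have x0 : rho0 < x by [].
rewrite sub0r normrN gtr0_norm ?rad_gt0 //; apply: rad_lt => //.
Unshelve. all: by end_near. Qed.

End ConformalRadius.

(** * The Einstein tensor and its flux *)

Local Arguments derive1n : simpl never.

Section EinsteinTensor.
Context {R : realType}.
Variables (G c rho0 : R) (m rad : R -> R) (g : 'rV[R]_4 -> 'M[R]_4).
Local Notation k := (G / c ^+ 2).
Local Notation dm i := (m^`(i))%classic.
Local Notation W := (radial_root G c m).
Local Notation M := (spacetime rho0).
Local Notation X := space_coord.
Local Notation e_ i := (delta_mx (0 : 'I_1) (i : 'I_4) : 'rV[R]_4).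

Hypothesis G_gt0 : 0 < G.
Hypothesis c_gt0 : 0 < c.
Hypothesis rho0_gt0 : 0 < rho0.
Hypothesis m_smooth : smooth_on_pos m.
Hypothesis redshift_gt0 : forall r, 0 < r -> 0 < r ^+ 2 - 2 * k * r * m r.
Hypothesis rad_inv : radial_inverse rho0 (conformal_radius G c rho0 m) rad.

Lemma is_derive_rho_of (p : 'rV[R]_4) i : 0 < rho_of p ->
  is_derive p (e_ i) (@rho_of R) (X p i / rho_of p).
Proof.
move=> p0; have s0 : 0 < p 0 1 ^+ 2 + p 0 2 ^+ 2 + p 0 3 ^+ 2 by rewrite -sqrtr_gt0.
have dsq j := is_derive_sqr (is_derive_entry i j p).
have ds := is_derive_add (is_derive_add (dsq 1) (dsq 2)) (dsq 3).
apply: is_derive_eq.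
  exact: (@is_derive_comp1 _ _ Num.sqrt _ p (e_ i) _ _ (is_derive1_sqrt s0) ds).
rewrite -/(rho_of p) /space_coord; clear ds dsq.
move: (rho_of p) p0 => x x0.
by move: i; apply: ord4_ind; rewrite /=; field; rewrite gt_eqF.
Qed.

(** Writing the derivative of h as [a * rho_of p] cancels the 1/rho of the gradient of rho. All
    functions with suffix 1 below are rho-derivatives divided by rho for this reason. *)
Lemma is_derive_radial (h : R -> R) (a : R) (p : 'rV[R]_4) i : 0 < rho_of p ->
  is_derive (rho_of p) 1 h (a * rho_of p) ->
  is_derive p (e_ i) (fun q => h (rho_of q)) (a * X p i).
Proof.
move=> p0 dh; apply: is_derive_eq.
  exact: (@is_derive_comp1 _ _ h _ p _ _ _ dh (is_derive_rho_of i p0)).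
by field; rewrite gt_eqF.
Qed.

Lemma space_coord_sqr (p : 'rV[R]_4) :
  X p 1 ^+ 2 + X p 2 ^+ 2 + X p 3 ^+ 2 = rho_of p ^+ 2.
Proof. by rewrite /space_coord rho_of_sqr. Qed.

(** Since W^2 / r^2 = 1 - 2 k m / r, this is e^(2 alpha) c^2; [space_coeff] is phi^4 = (r / rho)^2.
    The two slopes are their logarithmic derivatives divided by 2 rho. *)
Definition time_coeff (x : R) : R := c ^+ 2 * (W (rad x) ^+ 2 / rad x ^+ 2).
Definition space_coeff (x : R) : R := rad x ^+ 2 / x ^+ 2.
Definition time_slope (x : R) : R :=
  k * ((m (rad x) - rad x * dm 1 (rad x)) / (W (rad x) * x ^+ 2)).
Definition space_slope (x : R) : R := (W (rad x) / rad x - 1) / x ^+ 2.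

Definition time_slope1 (x : R) : R :=
  - (k * (rad x * dm 2 (rad x) / x ^+ 4))
  - time_slope x * ((rad x - k * m (rad x) - k * rad x * dm 1 (rad x)) / (W (rad x) * x ^+ 2)
                    + 2 / x ^+ 2).
Definition space_slope1 (x : R) : R :=
  time_slope x / x ^+ 2 * (W (rad x) / rad x) - 2 * space_slope x / x ^+ 2.

Section Derivatives.
Variables (x : R) (x0 : rho0 < x).

Let r0 : 0 < rad x := rad_gt0 rad_inv x0.
Let W0 : 0 < W (rad x) := radial_root_gt0 redshift_gt0 r0.
Let xp : 0 < x := lt_trans rho0_gt0 x0.
Let k0 : 0 < k.
Proof. by rewrite divr_gt0 ?exprn_gt0. Qed.

(** Eliminating m through W^2 = r^2 - 2 k r m removes the algebraic relation between W, r and m. The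
    identities rewritten with it are rational in independent variables, and [field] decides them. *)
Let mE : m (rad x) = (rad x ^+ 2 - W (rad x) ^+ 2) / (2 * k * rad x).
Proof.
rewrite radial_root_sqr //; move: k k0 => K K0.
by field; rewrite !gt_eqF.
Qed.

Let dr : is_derive x (1 : R) rad (W (rad x) / x).
Proof. exact: is_derive_rad rad_inv _ _. Qed.
Let dW := is_derive_radial_root_rad rho0_gt0 m_smooth redshift_gt0 rad_inv x0.
Let dmr i := is_derive_comp_rad rho0_gt0 m_smooth redshift_gt0 rad_inv x0
  (is_derive_derive1n m_smooth i r0).
Let dx : is_derive x (1 : R) (fun x : R => x) 1.
Proof. exact: is_derive_id. Qed.

Let rn0 : rad x != 0. Proof. by rewrite gt_eqF. Qed.
Let xn0 : x != 0. Proof. by rewrite gt_eqF. Qed.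
Let Wn0 : W (rad x) != 0. Proof. by rewrite gt_eqF. Qed.
Let kn0 : k != 0. Proof. by rewrite gt_eqF. Qed.

Lemma is_derive_time_coeff :
  is_derive x 1 time_coeff (2 * time_coeff x * time_slope x * x).
Proof.
have r2 : rad x ^+ 2 != 0 by rewrite expf_neq0.
have d := is_derive_mull (c ^+ 2) (is_derive_div (x := x)
  (g := fun y : R => rad y ^+ 2) r2 (is_derive_sqr dW) (is_derive_sqr dr)).
apply: is_derive_eq d _.
rewrite /time_coeff /time_slope /= mE.
move: (rad x) k (W _) (dm 1 _) rn0 xn0 Wn0 kn0 => r K w m1 r_n x_n w_n K_n.
by field; rewrite r_n x_n w_n K_n.
Qed.

Lemma is_derive_space_coeff :
  is_derive x 1 space_coeff (2 * space_coeff x * space_slope x * x).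
Proof.
have x2 : x ^+ 2 != 0 by rewrite expf_neq0.
have d := is_derive_div (x := x) (g := fun y : R => y ^+ 2) x2
  (is_derive_sqr dr) (is_derive_sqr dx).
apply: is_derive_eq d _; rewrite /space_coeff /space_slope /=.
move: (rad x) (W _) rn0 xn0 Wn0 => r w r_n x_n w_n.
by field; rewrite r_n x_n.
Qed.

Lemma is_derive_time_slope : is_derive x 1 time_slope (time_slope1 x * x).
Proof.
have Wx : W (rad x) * x ^+ 2 != 0 by rewrite mulf_neq0 ?expf_neq0.
have d := is_derive_mull k (is_derive_div (x := x) (g := fun y : R => W (rad y) * y ^+ 2) Wx
  (is_derive_sub (dmr 0) (is_derive_mul dr (dmr 1))) (is_derive_mul dW (is_derive_sqr dx))).
apply: is_derive_eq d _; rewrite /time_slope1 /time_slope /= derive1n0.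
move: (rad x) k (W _) (m _) (dm 1 _) (dm 2 _) rn0 xn0 Wn0 kn0 => r K w m0 m1 m2 r_n x_n w_n K_n.
by field; rewrite x_n w_n.
Qed.

Lemma is_derive_space_slope : is_derive x 1 space_slope (space_slope1 x * x).
Proof.
have x2 : x ^+ 2 != 0 by rewrite expf_neq0.
have d := is_derive_div (x := x) (g := fun y : R => y ^+ 2) x2
  (is_derive_sub (is_derive_div (x := x) (g := rad) rn0 dW dr) (is_derive_const (1 : R) x (1 : R)))
  (is_derive_sqr dx).
apply: is_derive_eq d _; rewrite /space_slope1 /time_slope /space_slope /= mE.
move: (rad x) k (W _) (dm 1 _) rn0 xn0 Wn0 kn0 => r K w m1 r_n x_n w_n K_n.
by field; rewrite r_n x_n w_n K_n.
Qed.

(* [A] is the eigenvalue of the mixed Einstein tensor on d_t and d_rho, and [B] the one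
   on the spheres. *)
Lemma einstein_coeffs :
  let u := time_slope x in let u1 := time_slope1 x in
  let v := space_slope x in let v1 := space_slope1 x in
  let A := - (2 * k * dm 1 (rad x)) / rad x ^+ 2 in
  let B := - (k * dm 2 (rad x)) / rad x in
  [/\ (6 * v + 2 * v1 * x ^+ 2 + v ^+ 2 * x ^+ 2) / space_coeff x = A,
      (2 * u + 2 * v + (u1 + v1 + u ^+ 2) * x ^+ 2) / space_coeff x = B &
      (v ^+ 2 - v1 - u1 - u ^+ 2 + 2 * u * v) / space_coeff x = (A - B) / x ^+ 2].
Proof.
rewrite /space_slope1 /time_slope1 /time_slope /space_slope /space_coeff /= mE.
move: (rad x) k (W _) (dm 1 _) (dm 2 _) rn0 xn0 Wn0 kn0 => r K w m1 m2 r_n x_n w_n K_n.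
by split; field; rewrite ?r_n ?x_n ?w_n ?K_n.
Qed.

Definition energy_density (x : R) : R :=
  - (2 * k * c) * (W (rad x) * dm 1 (rad x) / x ^+ 3).
Definition stress_density (x : R) : R :=
  - (k * c) * (W (rad x) * rad x * dm 2 (rad x) / x ^+ 3).
Definition energy_density1 (x : R) : R := - (2 * k * c) / x ^+ 5 *
  ((rad x - k * m (rad x) - k * rad x * dm 1 (rad x)) * dm 1 (rad x)
   + W (rad x) ^+ 2 * dm 2 (rad x) - 3 * W (rad x) * dm 1 (rad x)).
Definition stress_density1 (x : R) : R := - (k * c) / x ^+ 5 *
  ((rad x - k * m (rad x) - k * rad x * dm 1 (rad x)) * rad x * dm 2 (rad x)
   + W (rad x) ^+ 2 * dm 2 (rad x) + W (rad x) ^+ 2 * rad x * dm 3 (rad x)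
   - 3 * W (rad x) * rad x * dm 2 (rad x)).

Lemma is_derive_energy_density :
  is_derive x 1 energy_density (energy_density1 x * x).
Proof.
have x3 : x * x ^+ 2 != 0 by rewrite mulf_neq0 ?expf_neq0.
have d := is_derive_mull (- (2 * k * c)) (is_derive_div (x := x) (g := fun y : R => y * y ^+ 2) x3
  (is_derive_mul dW (dmr 1)) (is_derive_mul dx (is_derive_sqr dx))).
apply: is_derive_eq d _; rewrite /energy_density1 /=.
move: (rad x) k (W _) (m _) (dm 1 _) (dm 2 _) xn0 => r K w m0 m1 m2 x_n.
by field; rewrite x_n.
Qed.

Lemma is_derive_stress_density :
  is_derive x 1 stress_density (stress_density1 x * x).
Proof.
have x3 : x * x ^+ 2 != 0 by rewrite mulf_neq0 ?expf_neq0.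
have d := is_derive_mull (- (k * c)) (is_derive_div (x := x) (g := fun y : R => y * y ^+ 2) x3
  (is_derive_mul (is_derive_mul dW dr) (dmr 2)) (is_derive_mul dx (is_derive_sqr dx))).
apply: is_derive_eq d _; rewrite /stress_density1 /=.
move: (rad x) k (W _) (m _) (dm 1 _) (dm 2 _) (dm 3 _) xn0 => r K w m0 m1 m2 m3 x_n.
by field; rewrite x_n.
Qed.

(** The radial component of the contracted Bianchi identity, in density form, is an ordinary
    differential equation between the two eigenvalues. With explicit eigenvalues it is checked
    directly. *)
Lemma radial_bianchi : energy_density1 x =
  time_slope x * energy_density x
  + space_slope x * (energy_density x + 2 * stress_density x)
  - 2 * (energy_density x - stress_density x) / x ^+ 2.
Proof.
rewrite /energy_density1 /energy_density /stress_density /time_slope /space_slope mE.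
move: (rad x) k (W _) (dm 1 _) (dm 2 _) rn0 xn0 Wn0 kn0 => r K w m1 m2 r_n x_n w_n K_n.
by field; rewrite r_n x_n w_n K_n.
Qed.

End Derivatives.

Hypothesis gE : forall p, M p -> g p = diag_mx (row4 (- time_coeff (rho_of p))
  (space_coeff (rho_of p)) (space_coeff (rho_of p)) (space_coeff (rho_of p))).

Let M_gt0 p : M p -> 0 < rho_of p. Proof. exact: lt_trans. Qed.

Let time_coeff_gt0 p : M p -> 0 < time_coeff (rho_of p).
Proof.
move=> Mp; have r0 := rad_gt0 rad_inv Mp; have W0 := radial_root_gt0 redshift_gt0 r0.
by rewrite mulr_gt0 ?divr_gt0 ?exprn_gt0.
Qed.

Let space_coeff_gt0 p : M p -> 0 < space_coeff (rho_of p).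
Proof.
move=> Mp; have r0 := rad_gt0 rad_inv Mp.
by rewrite divr_gt0 ?exprn_gt0 // M_gt0.
Qed.

Let time_coeff_neq0 p : M p -> time_coeff (rho_of p) != 0.
Proof. by move=> Mp; rewrite gt_eqF ?time_coeff_gt0. Qed.

Let space_coeff_neq0 p : M p -> space_coeff (rho_of p) != 0.
Proof. by move=> Mp; rewrite gt_eqF ?space_coeff_gt0. Qed.

Let d_radial h a p : M p -> is_derive (rho_of p) 1 h (a * rho_of p) ->
  forall i, is_derive p (e_ i) (fun q => h (rho_of q)) (a * X p i).
Proof. by move=> Mp dh i; apply: is_derive_radial => //; exact: M_gt0. Qed.

Let dN p (Mp : M p) := d_radial Mp (is_derive_time_coeff Mp).
Let dS p (Mp : M p) := d_radial Mp (is_derive_space_coeff Mp).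
Let du p (Mp : M p) := d_radial Mp (is_derive_time_slope Mp).
Let dv p (Mp : M p) := d_radial Mp (is_derive_space_slope Mp).

Lemma christoffel_radial p l i j : M p -> christoffel g l i j p =
  static_christoffel (fun q => time_coeff (rho_of q)) (fun q => space_coeff (rho_of q))
    (fun q => time_slope (rho_of q)) (fun q => space_slope (rho_of q)) l i j p.
Proof.
exact: (@christoffel_static _ _ _ (fun q => time_coeff (rho_of q))
  (fun q => space_coeff (rho_of q)) (fun q => time_slope (rho_of q))
  (fun q => space_slope (rho_of q)) (@open_spacetime R rho0) gE time_coeff_neq0
  space_coeff_neq0 dN dS).
Qed.

Lemma vol_density_radial p : M p ->
  vol_density g p = c * W (rad (rho_of p)) * rad (rho_of p) ^+ 2 / rho_of p ^+ 3.
Proof.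
move=> Mp; have r0 := rad_gt0 rad_inv Mp; have W0 := radial_root_gt0 redshift_gt0 r0.
rewrite /vol_density gE // det_diag.
set V := c * _ * _ / _.
have V0 : 0 < V by rewrite divr_gt0 ?exprn_gt0 ?M_gt0 // !mulr_gt0 // exprn_gt0.
rewrite (_ : \prod_i _ = - V ^+ 2).
  by rewrite normrN normrX sqrtr_sqr normr_id gtr0_norm.
rewrite !big_ord_recl big_ord0 !mxE /= /V /time_coeff /space_coeff.
move: (rho_of p) (rad _) (W _) (M_gt0 Mp) r0 W0 => x r w x_gt0 r_gt0 w_gt0.
by field; rewrite !gt_eqF.
Qed.

Lemma einstein_density p mu nu : M p -> einstein g mu nu p * vol_density g p =
  (mu == nu)%:R * (if mu == 0 then energy_density (rho_of p) else stress_density (rho_of p))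
  + X p mu * X p nu * ((energy_density (rho_of p) - stress_density (rho_of p)) / rho_of p ^+ 2).
Proof.
move=> Mp; rewrite (@einstein_static _ _ _ (fun q => time_coeff (rho_of q))
  (fun q => space_coeff (rho_of q)) (fun q => time_slope (rho_of q))
  (fun q => space_slope (rho_of q)) (fun q => time_slope1 (rho_of q))
  (fun q => space_slope1 (rho_of q)) (@open_spacetime R rho0) gE time_coeff_neq0
  space_coeff_neq0 dN dS du dv) // !space_coord_sqr.
have [EA EB EC] := einstein_coeffs Mp.
rewrite vol_density_radial // mulrDl -(mulrA (_ * _)) EC.
rewrite (_ : _ / space_coeff _ = (mu == nu)%:R * (if mu == 0 then
  - (2 * k * dm 1 (rad (rho_of p))) / rad (rho_of p) ^+ 2
  else - (k * dm 2 (rad (rho_of p))) / rad (rho_of p))); last first.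
  by rewrite -[LHS]mulrA; congr (_ * _); case: ifP => _; rewrite ?EA ?EB.
have r0 := rad_gt0 rad_inv Mp.
rewrite /energy_density /stress_density.
move: (rho_of p) (rad _) (W _) (dm 1 _) (dm 2 _) (M_gt0 Mp) r0 k.
move=> x r w m1 m2 x_gt0 r_gt0 K.
by case: ifP => _; field; rewrite !gt_eqF.
Qed.

(** * The density flux and its coordinate divergence *)

Section Flux.
Variable psi : 'rV[R]_4 -> 'rV[R]_4.

(** The coefficient of x_i x_j: it lifts the eigenvalue in the radial direction from stress to
    stress + rho^2 shear = energy. *)
Definition shear_density (x : R) : R := (energy_density x - stress_density x) / x ^+ 2.
Definition shear_density1 (x : R) : R :=
  (energy_density1 x - stress_density1 x) / x ^+ 2 - 2 * shear_density x / x ^+ 2.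
Definition diag_density (mu : 'I_4) (x : R) : R :=
  if mu == 0 then energy_density x else stress_density x.
Definition diag_density1 (mu : 'I_4) (x : R) : R :=
  if mu == 0 then energy_density1 x else stress_density1 x.

Definition radial_part (p : 'rV[R]_4) : R :=
  X p 1 * psi p 0 1 + X p 2 * psi p 0 2 + X p 3 * psi p 0 3.

Definition flux (mu : 'I_4) (p : 'rV[R]_4) : R :=
  diag_density mu (rho_of p) * psi p 0 mu
  + shear_density (rho_of p) * (X p mu * radial_part p).

Definition component_partial (mu nu : 'I_4) (p : 'rV[R]_4) : R :=
  partial mu (fun q => psi q 0 nu) p.
Local Notation dpsi := component_partial.

(** The product rule applied to [flux]; the indicators of [mu != 0] appear because [X] at index 0 is
    the constant 0 and not a coordinate. *)
Definition flux_derivative (mu : 'I_4) (p : 'rV[R]_4) : R :=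
  let x := rho_of p in
  diag_density mu x * dpsi mu mu p + psi p 0 mu * (diag_density1 mu x * X p mu)
  + (shear_density x * (X p mu *
      (X p 1 * dpsi mu 1 p + X p 2 * dpsi mu 2 p + X p 3 * dpsi mu 3 p
       + (mu != 0)%:R * psi p 0 mu) + radial_part p * (mu != 0)%:R)
     + X p mu * radial_part p * (shear_density1 x * X p mu)).

Lemma is_derive_flux p mu : M p ->
  (forall nu, derivable (fun q => psi q 0 nu) p (e_ mu)) ->
  is_derive p (e_ mu) (flux mu) (flux_derivative mu p).
Proof.
move=> Mp psi_derivable.
have dP nu : is_derive p (e_ mu) (fun q => psi q 0 nu) (dpsi mu nu p) by split.
have dE := is_derive_energy_density Mp; have dQ := is_derive_stress_density Mp.
have x0 : rho_of p != 0 by rewrite gt_eqF ?M_gt0.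
have dD : is_derive p (e_ mu) (fun q => diag_density mu (rho_of q))
    (diag_density1 mu (rho_of p) * X p mu).
  rewrite /diag_density /diag_density1.
  by case: ifP => _; apply: d_radial.
have x2 : rho_of p ^+ 2 != 0 by rewrite expf_neq0.
have dH : is_derive p (e_ mu) (fun q => shear_density (rho_of q))
    (shear_density1 (rho_of p) * X p mu).
  apply: d_radial => //.
  have d := is_derive_div (x := rho_of p) (g := fun y : R => y ^+ 2) x2 (is_derive_sub dE dQ)
    (is_derive_sqr (is_derive_id _ _)).
  apply: is_derive_eq d _; rewrite /shear_density1 /shear_density /=.
  by field.
have dX nu := is_derive_mul (is_derive_space_coord p mu nu) (dP nu).
have dY := is_derive_add (is_derive_mul dD (dP mu)) (is_derive_mul dH
  (is_derive_mul (is_derive_space_coord p mu mu)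
     (is_derive_add (is_derive_add (dX 1) (dX 2)) (dX 3)))).
apply: is_derive_eq dY _; rewrite /flux_derivative /radial_part /=.
clear; rewrite /space_coord; move: (shear_density _) (shear_density1 _) => h h1.
by move: mu; apply: ord4_ind; rewrite /=; ring.
Qed.

Let T mu nu p : R := (mu == nu)%:R * diag_density mu (rho_of p)
  + X p mu * X p nu * shear_density (rho_of p).

(** The density form of the Bianchi identity, d_mu T^mu_l = T^mu_nu Gamma^nu_(mu l). The right-hand
    side is the divergence on the left, worked out for the shape delta + x x of T. *)
Let christoffel_contraction p l : M p ->
  \sum_mu \sum_nu T mu nu p * christoffel g nu mu l p =
  X p l * (energy_density1 (rho_of p)
    + 2 * (energy_density (rho_of p) - stress_density (rho_of p)) / rho_of p ^+ 2).
Proof.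
move=> Mp; rewrite (radial_bianchi Mp) addrNK.
have q0 : X p 1 ^+ 2 + X p 2 ^+ 2 + X p 3 ^+ 2 != 0.
  by rewrite space_coord_sqr expf_neq0 // gt_eqF ?M_gt0.
under eq_bigr => mu _ do under eq_bigr => nu _ do rewrite (christoffel_radial _ _ _ Mp).
rewrite !sum_ord4 /T /diag_density /shear_density /static_christoffel -!space_coord_sqr.
move: q0; rewrite /space_coord.
move: (energy_density _) (stress_density _) => E S.
move: (time_slope _) (space_slope _) (time_coeff _ / _) => u v w.
move: (p 0 1) (p 0 2) (p 0 3) (p 0 l) => x y z pl q0.
by move: l; apply: ord4_ind; rewrite /=; field.
Qed.

(** The Christoffel terms of the covariant derivative supply the derivative of T, which completes
    T^mu_nu d_mu psi^nu to d_mu (T^mu_nu psi^nu). Their 1/W disappears here. *)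
Lemma einstein_divergence p : M p ->
  einstein_cov_deriv g psi p * vol_density g p = \sum_mu flux_derivative mu p.
Proof.
move=> Mp; rewrite /einstein_cov_deriv mulr_suml.
have E mu : (\sum_nu einstein g mu nu p * cov_deriv g psi mu nu p) * vol_density g p =
    \sum_nu T mu nu p * dpsi mu nu p
    + \sum_l (\sum_nu T mu nu p * christoffel g nu mu l p) * psi p 0 l.
  rewrite mulr_suml; under [X in _ = _ + X]eq_bigr do rewrite mulr_suml.
  rewrite [X in _ = _ + X]exchange_big -big_split; apply: eq_bigr => nu _ /=.
  rewrite mulrAC einstein_density // -/(T mu nu p) /cov_deriv mulrDr; congr (_ + _).
  by rewrite mulr_sumr; apply: eq_bigr => l _; rewrite mulrA.
under eq_bigr do rewrite E; rewrite big_split /= [X in _ + X]exchange_big /=.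
under [X in _ + X]eq_bigr do rewrite -mulr_suml (christoffel_contraction _ Mp).
rewrite /T /flux_derivative /diag_density /diag_density1 /shear_density1.
rewrite /shear_density /radial_part; move: dpsi => D; rewrite !sum_ord4 /=.
have q0 : X p 1 ^+ 2 + X p 2 ^+ 2 + X p 3 ^+ 2 != 0.
  by rewrite space_coord_sqr expf_neq0 // gt_eqF ?M_gt0.
rewrite -!space_coord_sqr; move: q0; rewrite /space_coord /=.
move: (energy_density _) (stress_density _) => E0 S.
move: (energy_density1 _) (stress_density1 _) => E1 S1.
move: (p 0 1) (p 0 2) (p 0 3) (psi p) => x y z ps q0.
by field.
Qed.

Lemma flux_fieldE p mu : M p ->
  einstein_flux_field g psi p 0 mu * vol_density g p = flux mu p.
Proof.
move=> Mp; rewrite /einstein_flux_field mxE mulr_suml sum_ord4.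
rewrite !(mulrAC _ (psi _ _ _)) !einstein_density // /flux /diag_density /radial_part.
rewrite /shear_density /space_coord.
by move: mu; apply: ord4_ind; rewrite /=; ring.
Qed.

End Flux.

End EinsteinTensor.

(** * Integration *)

Lemma normr_Rintegral_le d (T : measurableType d) (R : realType)
    (mu : {measure set T -> \bar R}) (D : set T) (f : T -> R) (C : R) :
  measurable D -> (mu D < +oo)%E -> measurable_fun D f -> 0 <= C ->
  (forall x, D x -> `|f x| <= C) ->
  `|\int[mu]_(x in D) f x|%R <= C * fine (mu D).
Proof.
move=> mD Doo mf C0 fC.
have fi : mu.-integrable D (EFin \o f).
  apply: measurable_bounded_integrable => //; exists C; split; first exact: num_real.
  by move=> D' CD x Dx; exact: le_trans (fC _ Dx) (ltW CD).
rewrite (le_trans (le_normr_Rintegral mD fi)) // -lee_fin EFinM (@fineK _ (mu D)) ?ge0_fin_numE //.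
have /(_ mD) := integral_le_bound (mu := mu) (D := D) (f := EFin \o f) C%:E.
rewrite (_ : (\int[mu]_(x in D) `|(EFin \o f) x|)%E = (\int[mu]_(x in D) `|f x|)%R%:E).
  apply; [exact: measurable_int fi|by rewrite lee_fin|].
  by apply: aeW => x Dx; rewrite lee_fin; exact: fC.
by rewrite /Rintegral fineK //; apply: integrable_fin_num => //; exact: integrable_norm fi.
Qed.


(** * The fundamental theorem of calculus on an open interval *)

Section OneDimension.
Context {R : realType}.
Local Notation mu := (@lebesgue_measure R).

(** Nothing is assumed of the values at a and b. The fundamental theorem applies on [s, t] inside,
    the two end pieces cost at most C times their lengths, and s and t tend to the ends. *)
Lemma integral_derivative_itvoo (y dy : R -> R) (a b C : R) : a < b ->
  (forall s, a < s < b -> is_derive s (1 : R) y (dy s)) ->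
  (forall s, a < s < b -> {for s, continuous dy}) ->
  (forall s, a < s < b -> `|dy s| <= C) ->
  y s @[s --> a^'+] --> (0 : R) -> y s @[s --> b^'-] --> (0 : R) ->
  (\int[mu]_(s in `]a, b[) (dy s)%:E = 0)%E.
Proof.
move=> ab ydy dyc dyC ya yb.
have C0 : 0 <= C.
  by apply: le_trans (normr_ge0 _) (dyC ((a + b) / 2) _); apply/andP; split; lra.
have mdy : measurable_fun `]a, b[%classic dy.
  apply: open_continuous_measurable_fun; first exact: interval_open.
  by move=> s; rewrite inE /= in_itv /= => sab; exact: dyc.
have idy : mu.-integrable `]a, b[%classic (EFin \o dy).
  apply: measurable_bounded_integrable => //.
    by rewrite /= lebesgue_measure_itv /= lte_fin ab ltry.
  exists C; split; first exact: num_real.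
  by move=> D CD s /=; rewrite in_itv /= => sab; rewrite (le_trans (dyC _ sab)) // ltW.
have piece (i : interval R) (u v : R) : a <= u -> u <= v -> v <= b ->
    [set` i] `<=` `]a, b[%classic -> mu [set` i] = (v - u)%:E ->
    `|\int[mu]_(s in [set` i]) dy s|%R <= C * (v - u).
  move=> au uv vb sub mui.
  rewrite (_ : v - u = fine (mu [set` i])); last by rewrite mui.
  apply: normr_Rintegral_le => //; first exact: (eq_ind_r (fun x => (x < +oo)%E) (ltry _) mui).
    exact: measurable_funS mdy.
  by move=> s si; apply: dyC; have := sub _ si; rewrite /= in_itv.
have est s t : a < s -> s < t -> t < b ->
    `|\int[mu]_(s in `]a, b[) dy s|%R <= C * (s - a) + `|y t - y s| + C * (b - t).
  move=> aS st tb.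
  have i1 : mu.-integrable `]s, b[%classic (EFin \o dy).
    by apply: integrableS idy => //; apply: subset_itvr; rewrite bnd_simp ltW.
  have E1 := Rintegral_itvB (x := s) idy.
  have E2 := Rintegral_itvB (x := t) i1.
  rewrite !bnd_simp in E1 E2.
  have {}E1 := E1 (ltW aS) (lt_trans st tb); have {}E2 := E2 (ltW st) tb.
  have i2 : mu.-integrable `]s, t]%classic (EFin \o dy).
    by apply: integrableS i1 => //; apply: subset_itvl; rewrite bnd_simp.
  have sub_ab r : r \in `[s, t] -> a < r < b.
    by rewrite in_itv /= => /andP[sr rt]; rewrite (lt_le_trans aS sr) (le_lt_trans rt tb).
  have y_cont r : r \in `[s, t] -> {for r, continuous y}.
    move=> /sub_ab/ydy[dr _]; apply: differentiable_continuous; exact/derivable1_diffP.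
  have ftc : (\int[mu]_(r in `]s, t]) dy r)%R = y t - y s.
    rewrite (Rintegral_itv_obnd_cbnd i2) /Rintegral (continuous_FTC2 (F := y) st) //.
    - apply: continuous_in_subspaceT => r; rewrite inE => rst.
      by apply: dyc; exact: sub_ab.
    - split.
      + by move=> r /subset_itv_oo_cc/sub_ab/ydy[].
      + by apply: cvg_at_right_filter; apply: y_cont; rewrite in_itv /= lexx ltW.
      + by apply: cvg_at_left_filter; apply: y_cont; rewrite in_itv /= lexx ltW.
    - move=> r /subset_itv_oo_cc/sub_ab/ydy[_ <-]; exact: derive1E.
  have p1 : `|\int[mu]_(r in `]a, s]) dy r|%R <= C * (s - a).
    apply: piece; [by []|exact: ltW|exact/ltW/(lt_trans st)| |].
      by apply: subset_itvl; rewrite bnd_simp (lt_trans st).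
    by rewrite lebesgue_measure_itv /= lte_fin aS.
  have p3 : `|\int[mu]_(r in `]t, b[) dy r|%R <= C * (b - t).
    apply: piece; [exact/ltW/(lt_trans aS)|exact: ltW|by []| |].
      by apply: subset_itvr; rewrite bnd_simp ltW // (lt_trans aS).
    by rewrite lebesgue_measure_itv /= lte_fin tb.
  have -> : (\int[mu]_(r in `]a, b[) dy r)%R = (\int[mu]_(r in `]a, s]) dy r)%R
      + (y t - y s) + (\int[mu]_(r in `]t, b[) dy r)%R by rewrite -ftc -addrA -E2 -E1; ring.
  by rewrite (le_trans (ler_normD _ _)) // lerD // (le_trans (ler_normD _ _)) // lerD.
have I0 : (\int[mu]_(s in `]a, b[) dy s)%R = 0.
  apply/eqP; rewrite -normr_le0; apply/ler_addgt0Pr => e e0; rewrite add0r.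
  have C1 : 0 < C + 1 by lra.
  have e4 : 0 < e / 4 by lra.
  (* Four quarters of e: two end pieces and two boundary values. C + 1 is positive even when C =
     0. *)
  have eC : 0 < e / 4 / (C + 1) by rewrite divr_gt0.
  have abm : a < (a + b) / 2 by lra.
  have mab : (a + b) / 2 < b by lra.
  near a^'+ => s; near b^'- => t.
  have aS : a < s by [].
  have tb : t < b by [].
  have sm : s < (a + b) / 2 by near: s; exact: nbhs_right_lt.
  have mt : (a + b) / 2 < t by near: t; exact: nbhs_left_gt.
  have sC : s < a + e / 4 / (C + 1) by near: s; apply: nbhs_right_lt; lra.
  have tC : b - e / 4 / (C + 1) < t by near: t; apply: nbhs_left_gt; lra.
  have ys : `|0 - y s| < e / 4 by near: s; move/cvgrPdist_lt : ya; apply.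
  have yt : `|0 - y t| < e / 4 by near: t; move/cvgrPdist_lt : yb; apply.
  have small d : d <= e / 4 / (C + 1) -> 0 <= d -> C * d <= e / 4.
    move=> dle d0; rewrite (le_trans (ler_wpM2r d0 (_ : C <= C + 1))) ?lerDl //.
    by rewrite mulrC -ler_pdivlMr.
  rewrite !sub0r !normrN in ys yt.
  have Cs : C * (s - a) <= e / 4.
    by apply: small; [rewrite lerBlDl; exact: ltW|rewrite subr_ge0; exact: ltW].
  have Ct : C * (b - t) <= e / 4.
    by apply: small; [rewrite lerBlDr -lerBlDl; exact: ltW|rewrite subr_ge0; exact: ltW].
  rewrite (le_trans (est s t aS (lt_trans sm mt) tb)) //.
  rewrite (_ : e = e / 4 + (e / 4 + e / 4) + e / 4); last by field.
  by rewrite !lerD // (le_trans (ler_normB _ _)) // lerD // ltW.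
have fin : (\int[mu]_(s in `]a, b[) (dy s)%:E)%E \is a fin_num.
  by apply: (integrable_fin_num _ idy).
by rewrite -(fineK fin); congr EFin; exact: I0.
Unshelve. all: by end_near. Qed.

End OneDimension.

Section LineIntegral.
Context {R : realType}.
Local Notation mu := (@lebesgue_measure R).

(** A line parallel to a space axis at distance d from the spatial origin meets rho > rho0 where s^2
    > q = rho0^2 - d^2: everywhere for q < 0, on two half-lines otherwise. Only the latter case has
    finite ends, so the boundary condition is asked for q >= 0. *)
Lemma integral_line_eq0 (y dy : R -> R) (q K C : R) :
  (forall s, q < s ^+ 2 -> is_derive s (1 : R) y (dy s)) ->
  (forall s, q < s ^+ 2 -> {for s, continuous dy}) ->
  (forall s, q < s ^+ 2 -> `|dy s| <= C) ->
  (forall s, q < s ^+ 2 -> K < `|s| -> y s = 0) ->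
  (0 <= q -> forall e, 0 < e -> exists2 d, 0 < d &
     forall s, q < s ^+ 2 < q + d -> `|y s| < e) ->
  (\int[mu]_s (if (q < s ^+ 2)%R then dy s else 0%R)%:E = 0)%E.
Proof.
move=> ydy dyc dyC y0 ybd.
have open_near s : q < s ^+ 2 -> \forall r \near s, q < r ^+ 2.
  exact: (cvgr_gt _ (@exprn_continuous R 2 s)).
have dy0 s : q < s ^+ 2 -> K < `|s| -> dy s = 0.
  move=> qs Ks; have [_ <-] := ydy _ qs; rewrite -[RHS](derive_cst (0 : R) s (1 : R)).
  apply: near_eq_derive; near=> r; apply: y0.
    by near: r; exact: open_near.
  by near: r; exact: (cvgr_gt _ (@norm_continuous _ R s)).
(* [Num.sqrt] is 0 on negative numbers, so one choice of [l] and [b] serves both cases; [b] lies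
   beyond the support and beyond [l]. *)
pose l := Num.sqrt q; pose b := l + `|K| + 1.
have l0 : 0 <= l by exact: sqrtr_ge0.
have [Kb lb] : K < b /\ l < b.
  by rewrite /b; have := ler_norm K; have := normr_ge0 K; split; lra.
have qE s : 0 <= q -> (q < s ^+ 2) = (l < `|s|).
  by move=> q0; rewrite -{1}(sqr_sqrtr q0) -(real_normK (num_real s)) ltr_sqr ?nnegrE.
have q_gt s : l < `|s| -> q < s ^+ 2.
  have [q0|q0 _] := leP 0 q; first by rewrite qE.
  by rewrite (lt_le_trans q0) ?sqr_ge0.
have yb : y s @[s --> b^'-] --> (0 : R).
  apply: cvg_near_cst; near=> s.
  have Ks : Num.max K l < s by near: s; apply: nbhs_left_gt; rewrite gt_max Kb.
  move: Ks; rewrite gt_max => /andP[Ks ls].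
  by apply: y0; [apply: q_gt|]; rewrite ger0_norm // ltW // (le_lt_trans l0).
have yNb : y s @[s --> (- b)^'+] --> (0 : R).
  apply: cvg_near_cst; near=> s.
  have Ks : s < - Num.max K l.
    by near: s; apply: nbhs_right_lt; rewrite ltrN2 gt_max Kb.
  move: Ks; rewrite ltrNr gt_max => /andP[Ks ls].
  have s0 : s < 0 by rewrite -oppr_gt0 (le_lt_trans l0).
  by apply: y0; [apply: q_gt|]; rewrite ltr0_norm.
have [q0|q0] := ltP q 0.
  have qs s : q < s ^+ 2 by rewrite (lt_le_trans q0) ?sqr_ge0.
  transitivity (\int[mu]_(s in `](- b)%R, b[) (dy s)%:E)%E; last first.
    apply: (@integral_derivative_itvoo _ y dy _ _ C) => // [|s _|s _|s _].
    - lra.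
    - exact: ydy.
    - exact: dyc.
    - exact: dyC.
  rewrite [RHS]integral_mkcond; apply: eq_integral => s _.
  rewrite qs patchE; case: ifPn => // /negP; rewrite inE /= in_itv /= => /negP.
  rewrite -ltr_norml -leNgt => bs; rewrite dy0 //; exact: lt_le_trans bs.
have yl e : 0 < e -> exists2 d, 0 < d & forall s, l < `|s| < l + d -> `|y s| < e.
  move=> e0; have [d d0 yd] := ybd q0 _ e0.
  have : \forall s \near l, s ^+ 2 < q + d.
    apply: (cvgr_lt _ (@exprn_continuous R 2 l)).
    by rewrite sqr_sqrtr // ltrDl.
  case=> /= d' d'0 hd'; exists d' => // s /andP[ls sd].
  apply: yd; rewrite qE // ls /= -(real_normK (num_real s)); apply: hd' => /=.
  by rewrite distrC gtr0_norm ?subr_gt0 // ltrBlDl.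
have ylr : y s @[s --> l^'+] --> (0 : R).
  apply/cvgrPdist_lt => e /yl[d d0 yd]; near=> s.
  have ls : l < s by [].
  rewrite sub0r normrN; apply: yd; rewrite gtr0_norm ?ls ?(le_lt_trans l0) //=.
  by near: s; apply: nbhs_right_lt; rewrite ltrDl.
have yll : y s @[s --> (- l)^'-] --> (0 : R).
  apply/cvgrPdist_lt => e /yl[d d0 yd]; near=> s.
  have ls : s < - l by [].
  have s0 : s < 0 by rewrite (lt_le_trans ls) // oppr_le0.
  rewrite sub0r normrN; apply: yd; rewrite ltr0_norm // ltrNr ls /= ltrNl.
  by near: s; apply: nbhs_left_gt; rewrite opprD gtrDl oppr_lt0.
have q_gtP s : l < s -> q < s ^+ 2.
  by move=> ls; apply: q_gt; rewrite gtr0_norm //; exact: le_lt_trans ls.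
have q_gtN s : s < - l -> q < s ^+ 2.
  by move=> sl; rewrite -sqrrN; apply: q_gtP; rewrite ltrNr.
have lb' : - b < - l by rewrite ltrN2.
have I1 : (\int[mu]_(s in `](- b)%R, (- l)%R[) (dy s)%:E = 0)%E.
  have qs s : - b < s < - l -> q < s ^+ 2.
    by case/andP => _; exact: q_gtN.
  exact: (@integral_derivative_itvoo _ y dy _ _ C lb' (fun s h => ydy s (qs s h))
    (fun s h => dyc s (qs s h)) (fun s h => dyC s (qs s h)) yNb yll).
have I2 : (\int[mu]_(s in `]l, b[) (dy s)%:E = 0)%E.
  have qs s : l < s < b -> q < s ^+ 2.
    by case/andP => + _; exact: q_gtP.
  exact: (@integral_derivative_itvoo _ y dy _ _ C lb (fun s h => ydy s (qs s h))
    (fun s h => dyc s (qs s h)) (fun s h => dyC s (qs s h)) ylr yb).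
have mdy : measurable_fun (`](- b)%R, (- l)%R[%classic `|` `]l, b[%classic) dy.
  apply: open_continuous_measurable_fun; first by apply: openU; exact: interval_open.
  move=> s; rewrite inE /= !in_itv /= => sP; apply: dyc.
  by case: sP => /andP[s1 s2]; [exact: q_gtN|exact: q_gtP].
transitivity (\int[mu]_(s in `](- b)%R, (- l)%R[ `|` `]l, b[) (dy s)%:E)%E; last first.
  rewrite integral_setU_EFin // ?I1 ?I2 ?adde0 //.
  apply/disj_setPS => s [] /=; rewrite !in_itv /= => /andP[_ s1] /andP[s2 _].
  have := lt_trans s2 s1; lra.
rewrite [RHS]integral_mkcond; apply: eq_integral => s _.
rewrite patchE; have [qs|qs] := ifPn; last first.
  case: ifPn => //; rewrite inE /= !in_itv /= => sP; case/negP: qs.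
  by case: sP => /andP[s1 s2]; [exact: q_gtN|exact: q_gtP].
case: ifPn => // /negP; rewrite inE /= !in_itv /= => sN.
rewrite dy0 //; rewrite ltNge; apply/negP => sK; apply: sN.
move: qs; rewrite qE // => ls.
have [s0|s0] := leP 0 s.
  right; rewrite ger0_norm // in ls sK; rewrite ls /=; exact: le_lt_trans sK _.
left; rewrite ltr0_norm // in ls sK; rewrite ltrNl (le_lt_trans sK) //= ltrNr //.
Unshelve. all: by end_near. Qed.

End LineIntegral.

(* MathComp-Analysis resolves the sigma-finiteness of a product only when both
   factors are subprobabilities; the alias carries the general instance. *)
Section SigmaFiniteProduct.
Context d1 d2 (T1 : measurableType d1) (T2 : measurableType d2) (R : realType).
Variables (m1 : {sigma_finite_measure set T1 -> \bar R})
          (m2 : {sigma_finite_measure set T2 -> \bar R}).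

Definition sigma_finite_prod := (m1 \x m2)%E.

HB.instance Definition _ := Measure.on sigma_finite_prod.

Let sigma_finite_prodT : sigma_finite setT sigma_finite_prod.
Proof.
have /sigma_finiteP[F [TF ndF Foo]] := sigma_finiteT m1.
have /sigma_finiteP[G [TG ndG Goo]] := sigma_finiteT m2.
exists (fun n => F n `*` G n).
  rewrite -setXTT TF TG predeqE => -[x y]; split.
    move=> [/= [n _ Fnx] [k _ Gky]]; exists (maxn n k) => //; split.
    - by move: x Fnx; exact/subsetPset/ndF/leq_maxl.
    - by move: y Gky; exact/subsetPset/ndG/leq_maxr.
  by move=> [n _ []/= ? ?]; split; exists n.
move=> k; have [? ?] := Foo k; have [? ?] := Goo k.
split; first exact: measurableX.
by rewrite /sigma_finite_prod product_measure1E // lte_mul_pinfty // ge0_fin_numE.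
Qed.

HB.instance Definition _ :=
  Measure_isSigmaFinite.Build _ _ _ sigma_finite_prod sigma_finite_prodT.

End SigmaFiniteProduct.

(** * Integrability and measurability on products of lines *)

Section CoordinatewiseIntegration.
Context {R : realType}.
Local Notation leb := (@lebesgue_measure R).
Local Notation RM := (measurableTypeR R).

Lemma integrable_of_support d (T : measurableType d) (mu : {measure set T -> \bar R})
    (f : T -> R) (B : set T) (C : R) : measurable B -> (mu B < +oo)%E ->
  measurable_fun setT f -> (forall z, `|f z| <= C) -> (forall z, f z != 0 -> B z) ->
  mu.-integrable setT (EFin \o f).
Proof.
move=> mB muB mf fC fB.
have : mu.-integrable B (EFin \o f).
  apply: measurable_bounded_integrable => //; first exact: measurable_funTS.
  exists C; split; first exact: num_real.
  by move=> D CD z _; exact: le_trans (fC _) (ltW CD).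
move/(integrable_mkcond _ mB); congr (_.-integrable _ _).
apply/funext => z; rewrite patchE; case: ifPn => // /negP; rewrite inE => zB.
by rewrite /=; congr EFin; apply/esym/eqP; apply: contrapT => /negP /fB.
Qed.

Lemma prod_integral_eq0_r d1 d2 (T1 : measurableType d1) (T2 : measurableType d2)
    (m1 : {sigma_finite_measure set T1 -> \bar R})
    (m2 : {sigma_finite_measure set T2 -> \bar R}) (f : T1 * T2 -> \bar R) :
  (m1 \x m2)%E.-integrable setT f -> (forall x, (\int[m2]_y f (x, y) = 0)%E) ->
  (\int[m1 \x m2]_z f z = 0)%E.
Proof.
move=> fi f0; rewrite -(integral12_prod_meas1 fi); apply: integral0_eq => x _.
exact: f0.
Qed.

Lemma prod_integral_eq0_l d1 d2 (T1 : measurableType d1) (T2 : measurableType d2)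
    (m1 : {sigma_finite_measure set T1 -> \bar R})
    (m2 : {sigma_finite_measure set T2 -> \bar R}) (f : T1 * T2 -> \bar R) :
  (m1 \x m2)%E.-integrable setT f -> (forall y, (\int[m1]_x f (x, y) = 0)%E) ->
  (\int[m1 \x m2]_z f z = 0)%E.
Proof.
move=> fi f0; rewrite -(integral21_prod_meas1 fi); apply: integral0_eq => y _.
exact: f0.
Qed.

Local Notation leb2 := (leb \x leb)%E.
Local Notation leb3 := (leb \x leb \x leb)%E.
Local Notation leb4 := (leb \x leb \x leb \x leb)%E.

Let box1 (K : R) : set RM := `[(- K)%R, K]%classic.
Let box2 K : set (RM * RM) := box1 K `*` box1 K.
Let box3 K : set (RM * RM * RM) := box2 K `*` box1 K.
Let box4 K : set (RM * RM * RM * RM) := box3 K `*` box1 K.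

Let mbox1 K : measurable (box1 K). Proof. exact: measurable_itv. Qed.
Let mbox2 K : measurable (box2 K). Proof. exact: measurableX. Qed.
Let mbox3 K : measurable (box3 K). Proof. exact: measurableX. Qed.
Let mbox4 K : measurable (box4 K). Proof. exact: measurableX. Qed.

Let box1_lty K : (leb (box1 K) < +oo)%E.
Proof.
rewrite /= lebesgue_measure_itv /=; case: ifP => _; last exact: ltry.
exact: ltry.
Qed.
Lemma product_measure_lty d1 d2 (T1 : measurableType d1) (T2 : measurableType d2)
    (m1 : {measure set T1 -> \bar R}) (m2 : {sigma_finite_measure set T2 -> \bar R}) A B :
  measurable A -> measurable B -> (m1 A < +oo)%E -> (m2 B < +oo)%E ->
  ((m1 \x m2) (A `*` B) < +oo)%E.
Proof.
move=> mA mB Aoo Boo; rewrite product_measure1E //; apply: lte_mul_pinfty => //.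
by rewrite ge0_fin_numE.
Qed.

Let box2_lty K : (leb2 (box2 K) < +oo)%E.
Proof. exact: (product_measure_lty (mbox1 K) (mbox1 K) (box1_lty K) (box1_lty K)). Qed.
Let box3_lty K : (leb3 (box3 K) < +oo)%E.
Proof. exact: (product_measure_lty (mbox2 K) (mbox1 K) (box2_lty K) (box1_lty K)). Qed.
Let box4_lty K : (leb4 (box4 K) < +oo)%E.
Proof. exact: (product_measure_lty (mbox3 K) (mbox1 K) (box3_lty K) (box1_lty K)). Qed.

Lemma integrable_box2 (f : RM * RM -> R) (C K : R) : measurable_fun setT f ->
  (forall z, `|f z| <= C) -> (forall z, f z != 0 -> `|z.1| <= K /\ `|z.2| <= K) ->
  leb2.-integrable setT (EFin \o f).
Proof.
move=> mf fC fK; apply: (integrable_of_support (mbox2 K) (box2_lty K) mf fC) => z /fK.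
by rewrite /box2 /box1 /= !in_itv /= !ler_norml.
Qed.

Lemma integrable_box3 (f : RM * RM * RM -> R) (C K : R) : measurable_fun setT f ->
  (forall z, `|f z| <= C) ->
  (forall z, f z != 0 -> [/\ `|z.1.1| <= K, `|z.1.2| <= K & `|z.2| <= K]) ->
  leb3.-integrable setT (EFin \o f).
Proof.
move=> mf fC fK; apply: (integrable_of_support (mbox3 K) (box3_lty K) mf fC) => z /fK.
by rewrite /box3 /box2 /box1 /= !in_itv /= !ler_norml => -[].
Qed.

Lemma integrable_box4 (f : RM * RM * RM * RM -> R) (C K : R) : measurable_fun setT f ->
  (forall z, `|f z| <= C) ->
  (forall z, f z != 0 ->
     [/\ `|z.1.1.1| <= K, `|z.1.1.2| <= K, `|z.1.2| <= K & `|z.2| <= K]) ->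
  leb4.-integrable setT (EFin \o f).
Proof.
move=> mf fC fK; apply: (integrable_of_support (mbox4 K) (box4_lty K) mf fC) => z /fK.
by rewrite /box4 /box3 /box2 /box1 /= !in_itv /= !ler_norml => -[].
Qed.

(** An open set is the union of the countably many boxes with rational centre and half-width that it
    contains, hence measurable for the product sigma-algebra. *)
Lemma measurable_point4 (U : set 'rV[R]_4) : open U ->
  measurable (@point4 R @^-1` U : set (RM * RM * RM * RM)).
Proof.
move=> oU.
pose box (i : rat * rat * rat * rat * rat) : set (RM * RM * RM * RM) :=
  let I (q : rat) : set RM :=
    `](ratr q - ratr i.2 : R)%R, (ratr q + ratr i.2 : R)%R[%classic in
  I i.1.1.1.1 `*` I i.1.1.1.2 `*` I i.1.1.2 `*` I i.1.2.
pose F i := if `[< box i `<=` @point4 R @^-1` U >] then box i else set0.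
rewrite (_ : _ @^-1` _ = \bigcup_i F i); last first.
  apply/seteqP; split => [z Uz|z [i _]]; last first.
    by rewrite /F; case: asboolP => // sub /sub.
  have /nbhs_ballP[e /= e0 eU] : nbhs (point4 z) U by exact: open_nbhs_nbhs.
  have e2 : 0 < e / 2 by lra.
  (* The centre is within d of z and the box has half-width d, so its points are within 2 d < e of
     z. *)
  have [d] := rat_in_itvoo e2; rewrite in_itv /= => /andP[d0 de].
  have near_rat (x : R) : exists q : rat, x - ratr d < ratr q < x + ratr d.
    have [|q] := @rat_in_itvoo R (x - ratr d) (x + ratr d); first lra.
    by rewrite in_itv /=; exists q.
  have [q1 /andP[a1 b1]] := near_rat z.1.1.1; have [q2 /andP[a2 b2]] := near_rat z.1.1.2.
  have [q3 /andP[a3 b3]] := near_rat z.1.2; have [q4 /andP[a4 b4]] := near_rat z.2.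
  exists (q1, q2, q3, q4, d) => //; rewrite /F; case: asboolP => [_|].
    by rewrite /box /= !in_itv /=; do !split; apply/andP; split; lra.
  case => w; rewrite /box /= !in_itv /=.
  move=> -[[[/andP[c1 d1] /andP[c2 d2]] /andP[c3 d3]] /andP[c4 d4]].
  apply: eU; split => // i j; rewrite (ord1 i); move: j.
  by apply: ord4_ind; rewrite /point4 !row4E /ball /= ltr_norml; apply/andP; split; lra.
apply: countable_bigcupT_measurable => // i; rewrite /F; case: asboolP => // _.
by rewrite /box /=; do 3?apply: measurableX => //; exact: measurable_itv.
Qed.

Lemma measurable_fun_point4 (U : set 'rV[R]_4) (h : 'rV[R]_4 -> R) : open U ->
  (forall p, U p -> {for p, continuous h}) ->
  measurable_fun (@point4 R @^-1` U : set (RM * RM * RM * RM)) (h \o @point4 R).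
Proof.
move=> oU hc; move=> mD; apply: (measurability _ (RGenOpens.measurableE R)) => //.
move=> _ [_ [a [b ->] <-]]; apply: (@measurable_point4 (U `&` h @^-1` `]a, b[%classic)).
rewrite openE => p [Up hp].
apply: filterI; first exact: open_nbhs_nbhs.
by apply: hc => //; apply: open_nbhs_nbhs; split => //; exact: interval_open.
Qed.


End CoordinatewiseIntegration.

(** * Vanishing integral of a coordinate derivative *)

Section CoordinateDerivatives.
Context {R : realType}.
Local Notation leb := (@lebesgue_measure R).
Local Notation RM := (measurableTypeR R).
Local Notation leb2 := (leb \x leb)%E.
Local Notation leb3 := (leb \x leb \x leb)%E.
Local Notation leb4 := (leb \x leb \x leb \x leb)%E.

Local Notation M rho0 := (spacetime rho0).
Local Notation e_ i := (delta_mx (0 : 'I_1) (i : 'I_4) : 'rV[R]_4).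

Lemma rho_of_line (p : 'rV[R]_4) (s : R) (mu : 'I_4) : p 0 mu = 0 ->
  rho_of (s *: e_ mu + p) ^+ 2 = (if mu == 0 then 0 else s ^+ 2) + rho_of p ^+ 2.
Proof.
rewrite !rho_of_sqr !mxE; move: mu; apply: ord4_ind => p0; rewrite /= ?p0; ring.
Qed.

Section CoordinateDerivative.
Variables (rho0 K C : R) (mu : 'I_4) (y dy : 'rV[R]_4 -> R).
Hypothesis rho0_gt0 : 0 < rho0.
Hypothesis y_deriv : forall p, M rho0 p -> is_derive p (e_ mu) y (dy p).
Hypothesis dy_cont : forall p, M rho0 p -> {for p, continuous dy}.
Hypothesis dy_bound : forall p, M rho0 p -> `|dy p| <= C.
Hypothesis y_support : forall p i, M rho0 p -> K < `|p 0 i| -> y p = 0.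
Hypothesis dy_support : forall p i, M rho0 p -> K < `|p 0 i| -> dy p = 0.
Hypothesis y_boundary : forall e, 0 < e -> exists2 d, 0 < d &
  forall p, rho0 < rho_of p < rho0 + d -> `|y p| < e.

Let h (p : 'rV[R]_4) : R := if (rho0 < rho_of p)%R then dy p else 0%R.

Let line_eq0 (p : 'rV[R]_4) : p 0 mu = 0 -> (\int[leb]_s (h (s *: e_ mu + p))%:E = 0)%E.
Proof.
move=> pmu; pose L (s : R) := s *: e_ mu + p.
have L_cont s : {for s, continuous L}.
  by apply: continuousD; [exact: scalel_continuous|exact: cst_continuous].
have yL s : M rho0 (L s) -> is_derive s (1 : R) (y \o L) ((dy \o L) s).
  by move=> Ms; exact: (proj1 (@is_derive_line R _ y p (e_ mu) (dy (L s)) s) (y_deriv Ms)).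
have dyL s : M rho0 (L s) -> {for s, continuous (dy \o L)}.
  move=> Ms; apply: (@continuous_comp _ _ _ L dy); first exact: L_cont.
  exact: dy_cont.
have yK s : M rho0 (L s) -> K < `|s| -> (y \o L) s = 0.
  move=> Ms Ks; apply: (@y_support _ mu) => //.
  by rewrite /L !mxE !eqxx mulr1 pmu addr0.
have rho_ge0 q : 0 <= @rho_of R q by exact: sqrtr_ge0.
have := @rho_of_line p _ mu pmu; case: (altP (mu =P 0)) => [mu0|mu0] rhoE.
  have LE s : rho_of (L s) = rho_of p.
    by apply/eqP; rewrite -(@eqrXn2 _ 2) // rhoE add0r.
  have [pM|pM] := boolP (rho0 < rho_of p); last first.
    by apply: integral0_eq => s _; rewrite /h -/(L s) LE (negbTE pM).
  have LM s : M rho0 (L s) by rewrite /spacetime /= LE.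
  (* On a time line rho is constant, so the line lies entirely inside the domain; q = -1 makes the
     condition on s^2 always true. *)
  have q1 (s : R) : -1 < s ^+ 2 by rewrite (lt_le_trans _ (sqr_ge0 s)) // ltrN10.
  rewrite -(@integral_line_eq0 R (y \o L) (dy \o L) (-1) K C (fun s _ => yL s (LM s))
    (fun s _ => dyL s (LM s)) (fun s _ => dy_bound (LM s)) (fun s _ => yK s (LM s))).
    by apply: eq_integral => s _; rewrite q1 /h -/(L s) LE pM.
  by rewrite leNgt ltrN10.
have LM s : (rho0 ^+ 2 - rho_of p ^+ 2 < s ^+ 2) = (rho0 < rho_of (L s)).
  by rewrite ltrBlDr -rhoE ltr_sqr ?nnegrE // ltW.
pose LM1 s (H : rho0 ^+ 2 - rho_of p ^+ 2 < s ^+ 2) : M rho0 (L s) :=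
  eq_ind _ is_true H _ (LM s).
rewrite -(@integral_line_eq0 R (y \o L) (dy \o L) (rho0 ^+ 2 - rho_of p ^+ 2) K C
  (fun s H => yL s (LM1 s H)) (fun s H => dyL s (LM1 s H))
  (fun s H => dy_bound (LM1 s H)) (fun s H => yK s (LM1 s H))).
  by apply: eq_integral => s _; rewrite LM.
(* In terms of s^2 the shell has width (rho0 + d)^2 - rho0^2 = 2 rho0 d + d^2, which exceeds rho0
   d. *)
move=> _ e e0; have [d d0 yd] := y_boundary e0; exists (rho0 * d); first exact: mulr_gt0.
move=> s /andP[s1 s2]; apply: yd; rewrite -LM s1 /=.
have rd0 : 0 <= rho0 + d by rewrite addr_ge0 // ltW.
rewrite -ltr_sqr ?nnegrE // (rhoE s : rho_of (L s) ^+ 2 = _).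
rewrite (_ : s ^+ 2 + _ = s ^+ 2 - (rho0 ^+ 2 - rho_of p ^+ 2) + rho0 ^+ 2); last by ring.
rewrite -ltrBrDr (lt_trans (_ : _ < rho0 * d)) ?ltrBlDl //.
rewrite -subr_gt0 (_ : _ - _ = rho0 * d + d ^+ 2); last by ring.
by rewrite addr_gt0 // ?mulr_gt0 // exprn_gt0.
Qed.

Let H (z : RM * RM * RM * RM) : R := h (point4 z).

Let H_bound z : `|H z| <= `|C|.
Proof.
rewrite /H /h; case: ifPn => zM; last by rewrite normr0.
exact: le_trans (dy_bound zM) (ler_norm C).
Qed.

Let H_support z i : H z != 0 -> `|point4 z 0 i| <= K.
Proof.
rewrite /H /h; case: ifPn => zM; last by rewrite eqxx.
by apply: contraTT; rewrite -ltNge => /(dy_support zM) ->; rewrite eqxx.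
Qed.

Let mH : measurable_fun setT H.
Proof.
have := measurable_fun_point4 (open_spacetime (rho0 := rho0)) dy_cont.
have mM := measurable_point4 (open_spacetime (rho0 := rho0)).
move/(measurable_restrictT _ mM); congr (measurable_fun _ _).
apply/funext => z; rewrite patchE /H /h.
case: ifPn => [|/negP]; rewrite inE /= => zM; first by rewrite ifT.
by rewrite ifF //; exact/negP.
Qed.

Let H_box z : H z != 0 ->
  [/\ `|z.1.1.1| <= K, `|z.1.1.2| <= K, `|z.1.2| <= K & `|z.2| <= K].
Proof.
move=> Hz; have := H_support 0 Hz; have := H_support 1 Hz.
by have := H_support 2 Hz; have := H_support 3 Hz; rewrite /point4 !row4E.
Qed.

Lemma coordinate_integrable : leb4.-integrable setT (EFin \o H).
Proof. exact: integrable_box4 mH H_bound H_box. Qed.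

(** Fubini provides almost every slice; the iteration needs all of them, and each is bounded with
    bounded support. *)
Let integrable_slice3 (z4 : RM) : leb3.-integrable setT (fun z => (H (z, z4))%:E).
Proof.
apply: (@integrable_box3 _ (fun z => H (z, z4)) `|C| K) => [|z|z /H_box[]//].
  exact: measurable_fun_pair1.
exact: H_bound.
Qed.

Let integrable_slice2 (z3 z4 : RM) : leb2.-integrable setT (fun z => (H (z, z3, z4))%:E).
Proof.
apply: (@integrable_box2 _ (fun z => H (z, z3, z4)) `|C| K) => [|z|z /H_box[]//].
  apply: (@measurable_fun_pair1 _ _ _ _ _ _ (fun z => H (z, z4))).
  exact: measurable_fun_pair1.
exact: H_bound.
Qed.

(** The order of integration is chosen so that coordinate [mu] is innermost; the product is nested
    to the left, which leaves one chain of Fubini steps for each [mu]. *)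
Lemma coordinate_integral_eq0 : (\int[leb4]_z (H z)%:E = 0)%E.
Proof.
have line (p : 'rV[R]_4) (z : R -> R * R * R * R) : p 0 mu = 0 ->
    (forall s, point4 (z s) = s *: e_ mu + p) -> (\int[leb]_s (H (z s))%:E = 0)%E.
  move=> p0 zE; rewrite -(line_eq0 p0).
  by apply: eq_integral => s _; rewrite /H zE.
have : [\/ mu = 0, mu = 1, mu = 2 | mu = 3].
  by move: {+}mu; apply: ord4_ind; constructor.
case=> mE.
- refine (@prod_integral_eq0_l _ _ _ _ _ (sigma_finite_prod (sigma_finite_prod leb leb) leb) leb
    (fun z => (H z)%:E) coordinate_integrable _) => z4.
  refine (@prod_integral_eq0_l _ _ _ _ _ (sigma_finite_prod leb leb) leb
    (fun z => (H (z, z4))%:E) (integrable_slice3 z4) _) => z3.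
  refine (@prod_integral_eq0_l _ _ _ _ _ leb leb
    (fun z => (H (z, z3, z4))%:E) (integrable_slice2 z3 z4) _) => z2.
  apply: (line (row4 0 z2 z3 z4)); first by rewrite mE row4E.
  by move=> s; rewrite mE; apply/rowP; apply: ord4_ind; rewrite /point4 !mxE /=; ring.
- refine (@prod_integral_eq0_l _ _ _ _ _ (sigma_finite_prod (sigma_finite_prod leb leb) leb) leb
    (fun z => (H z)%:E) coordinate_integrable _) => z4.
  refine (@prod_integral_eq0_l _ _ _ _ _ (sigma_finite_prod leb leb) leb
    (fun z => (H (z, z4))%:E) (integrable_slice3 z4) _) => z3.
  refine (@prod_integral_eq0_r _ _ _ _ _ leb leb
    (fun z => (H (z, z3, z4))%:E) (integrable_slice2 z3 z4) _) => z1.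
  apply: (line (row4 z1 0 z3 z4)); first by rewrite mE row4E.
  by move=> s; rewrite mE; apply/rowP; apply: ord4_ind; rewrite /point4 !mxE /=; ring.
- refine (@prod_integral_eq0_l _ _ _ _ _ (sigma_finite_prod (sigma_finite_prod leb leb) leb) leb
    (fun z => (H z)%:E) coordinate_integrable _) => z4.
  refine (@prod_integral_eq0_r _ _ _ _ _ (sigma_finite_prod leb leb) leb
    (fun z => (H (z, z4))%:E) (integrable_slice3 z4) _) => z12.
  apply: (line (row4 z12.1 z12.2 0 z4)); first by rewrite mE row4E.
  by move=> s; rewrite mE; apply/rowP; apply: ord4_ind; rewrite /point4 !mxE /=; ring.
- refine (@prod_integral_eq0_r _ _ _ _ _ (sigma_finite_prod (sigma_finite_prod leb leb) leb) leb
    (fun z => (H z)%:E) coordinate_integrable _) => z123.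
  apply: (line (row4 z123.1.1 z123.1.2 z123.2 0)); first by rewrite mE row4E.
  by move=> s; rewrite mE; apply/rowP; apply: ord4_ind; rewrite /point4 !mxE /=; ring.
Qed.

End CoordinateDerivative.

End CoordinateDerivatives.

(** * Regularity up to the boundary *)

Section Tame.
Context {R : realType}.

(* Continuity on [D] together with boundedness up to the frontier of [D], on sets
   of bounded [size]. *)
Definition tame (T : topologicalType) (D : set T) (size h : T -> R) : Prop :=
  (forall p, D p -> {for p, continuous h}) /\
  forall K, exists C, forall p, D p -> size p <= K -> `|h p| <= C.

Section Closure.
Context {T : topologicalType} {D : set T} {size : T -> R}.
Local Notation tame := (tame D size).

Lemma tame_const (a : R) : tame (fun=> a).
Proof. by split=> [p _|K]; [exact: cst_continuous|exists `|a|]. Qed.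

Lemma tame_add (f h : T -> R) : tame f -> tame h -> tame (fun p => f p + h p).
Proof.
move=> [fc fb] [hc hb]; split=> [p Dp|K].
  by apply: continuousD; [exact: fc|exact: hc].
have [[Cf fC] [Ch hC]] := (fb K, hb K); exists (Cf + Ch) => p Dp pK.
by rewrite (le_trans (ler_normD _ _)) // lerD ?fC ?hC.
Qed.

Lemma tame_mul (f h : T -> R) : tame f -> tame h -> tame (fun p => f p * h p).
Proof.
move=> [fc fb] [hc hb]; split=> [p Dp|K].
  by apply: continuousM; [exact: fc|exact: hc].
have [[Cf fC] [Ch hC]] := (fb K, hb K); exists (Cf * Ch) => p Dp pK.
by rewrite normrM ler_pM ?fC ?hC.
Qed.

Lemma tame_opp (f : T -> R) : tame f -> tame (fun p => - f p).
Proof.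
move=> tf; rewrite (_ : (fun p => - f p) = fun p => -1 * f p).
  by apply: tame_mul => //; exact: tame_const.
by apply/funext => p; rewrite mulN1r.
Qed.

Lemma tame_sub (f h : T -> R) : tame f -> tame h -> tame (fun p => f p - h p).
Proof. by move=> tf th; apply: tame_add => //; exact: tame_opp. Qed.

Lemma tame_sqr (f : T -> R) : tame f -> tame (fun p => f p ^+ 2).
Proof. by move=> tf; exact: (tame_mul tf tf). Qed.

End Closure.

Lemma tame_coord (D : set 'rV[R]_4) i : tame D Num.norm (fun p => p 0 i).
Proof.
split=> [p _|K]; first exact: coord_continuous.
by exists K => p _; exact/le_trans/ler_norm_entry.
Qed.

Lemma tame_space_coord (D : set 'rV[R]_4) i : tame D Num.norm (fun p => space_coord p i).
Proof.
rewrite /space_coord; case: eqP => _; [exact: tame_const|exact: tame_coord].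
Qed.

Lemma tame_exprV (rho0 : R) n : 0 < rho0 ->
  tame [set x | rho0 < x] id (fun x => (x ^+ n)^-1).
Proof.
move=> r0; split=> [x /= x0|K].
  have xp : 0 < x by exact: lt_trans x0.
  apply: (@continuousV _ _ (fun x : R => x ^+ n)); first by rewrite expf_neq0 // gt_eqF.
  exact: exprn_continuous.
exists (rho0 ^+ n)^-1 => x /= x0 _; have xp : 0 < x by exact: lt_trans x0.
have [xn rn] : 0 < x ^+ n /\ 0 < rho0 ^+ n by rewrite !exprn_gt0.
rewrite gtr0_norm ?invr_gt0 // lef_pV2 ?posrE //.
by apply: lerXn2r; rewrite ?nnegrE; exact: ltW.
Qed.

Lemma tame_radial (rho0 : R) (h : R -> R) : tame [set x | rho0 < x] id h ->
  tame (spacetime rho0) Num.norm (fun p => h (rho_of p)).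
Proof.
case=> hc hb; split=> [p pM|K].
  by apply: (@continuous_comp _ _ _ (@rho_of R) h); [exact: rho_of_continuous|exact: hc].
(* The norm of a row is the sup norm, so rho is at most sqrt 3 times |K|, and sqrt 3 < 2. *)
have [C hC] := hb (2 * `|K|); exists C => p pM pK; apply: hC => //.
have bound i : p 0 i ^+ 2 <= K ^+ 2.
  rewrite -(real_normK (num_real (p 0 i))) -(real_normK (num_real K)).
  rewrite lerXn2r ?nnegrE // (le_trans (ler_norm_entry p i)) //.
  exact: le_trans pK (ler_norm K).
have K2 : 0 <= 2 * `|K| by rewrite mulr_ge0.
rewrite /rho_of -(ger0_norm K2) -sqrtr_sqr ler_sqrt ?sqr_ge0 // exprMn real_normK ?num_real //.
have := bound 1; have := bound 2; have := bound 3; have := sqr_ge0 K; lra.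
Qed.

End Tame.

(** * Bounds for the radial densities up to the boundary *)

Section RadialDensities.
Context {R : realType}.
Variables (G c rho0 : R) (m rad : R -> R) (a : nat -> R).
Local Notation k := (G / c ^+ 2).
Local Notation dm i := (m^`(i))%classic.
Local Notation W := (radial_root G c m).
Local Notation tame := (tame [set x | rho0 < x] id).

Hypothesis rho0_gt0 : 0 < rho0.
Hypothesis m_smooth : smooth_on_pos m.
Hypothesis redshift_gt0 : forall r, 0 < r -> 0 < r ^+ 2 - 2 * k * r * m r.
Hypothesis rad_inv : radial_inverse rho0 (conformal_radius G c rho0 m) rad.
Hypothesis m_series : abs_power_series_at0 m a.

Let rad_cont x : rho0 < x -> {for x, continuous rad}.
Proof.
move=> x0; apply: differentiable_continuous; apply/derivable1_diffP.
by case: (is_derive_rad rho0_gt0 m_smooth redshift_gt0 rad_inv x0).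
Qed.

Let rad_le x y : rho0 < x -> x <= y -> rad x <= rad y.
Proof.
move=> x0 xy; have y0 := lt_le_trans x0 xy; rewrite leNgt; apply/negP => yx.
have := conformal_radius_lt rho0_gt0 m_smooth redshift_gt0 rad_inv (rad_gt0 rad_inv y0) yx.
by rewrite !(conformal_radiusK rad_inv) // ltNge xy.
Qed.

(** Since [rad] is increasing, rho <= K becomes r <= [rad K], and on such a range boundedness near 0
    together with continuity gives a bound. *)
Lemma tame_comp_rad (h : R -> R) : (forall r, 0 < r -> {for r, continuous h}) ->
  (exists C, \forall r \near 0^'+, `|h r| <= C) -> tame (fun x => h (rad x)).
Proof.
move=> hc hb; split=> [x x0|K].
  apply: (@continuous_comp _ _ _ rad h); first exact: rad_cont.
  by apply: hc; exact: (rad_gt0 rad_inv x0).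
have [C _ hC] := continuous_pos_bounded hc hb (rad K); exists C => x x0 xK.
by apply: hC; rewrite (rad_gt0 rad_inv x0) rad_le.
Qed.

Lemma tame_derive1n_rad i : tame (fun x => dm i (rad x)).
Proof.
apply: tame_comp_rad; last exact: power_series_derive1n_bounded m_series.
move=> r r0; apply: differentiable_continuous; apply/derivable1_diffP.
exact: m_smooth.
Qed.

Lemma tame_rad : tame rad.
Proof.
apply: (@tame_comp_rad id) => [r _|]; first exact: cvg_id.
exists 1; near=> r; have r0 : 0 < r by [].
by rewrite ger0_norm ?ltW //; near: r; exact: nbhs_right_lt.
Unshelve. all: by end_near. Qed.

Lemma radial_root_cvg0 : W r @[r --> 0^'+] --> (0 : R).
Proof.
have [C Cm] := power_series_derive1n_bounded 0 m_series.
apply/cvgrPdist_lt => e e0.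
(* For r < 1 one has W^2 = r (r - 2 k m) <= r (1 + 2 |k| |C|), where C bounds m. *)
have D0 : 0 < 1 + 2 * `|k| * `|C| by rewrite ltr_pwDl // !mulr_ge0.
near=> r; have r0 : 0 < r by [].
have r1 : r < 1 by near: r; exact: nbhs_right_lt.
have rD : r < e ^+ 2 / (1 + 2 * `|k| * `|C|).
  by near: r; apply: nbhs_right_lt; rewrite divr_gt0 ?exprn_gt0.
have mC : `|m r| <= `|C|.
  by apply: le_trans (ler_norm C); near: r.
rewrite sub0r normrN ger0_norm ?sqrtr_ge0 // -ltr_sqr ?nnegrE ?sqrtr_ge0 ?ltW //.
rewrite radial_root_sqr //.
rewrite ltr_pdivlMr // in rD; apply: le_lt_trans rD.
rewrite (_ : _ - _ = r * (r - 2 * k * m r)); last by ring.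
apply: ler_wpM2l; first exact: ltW.
apply: lerD; first exact: ltW.
rewrite (le_trans (ler_norm _)) // normrN !normrM normr_nat.
by rewrite ler_wpM2l // mulr_ge0.
Unshelve. all: by end_near. Qed.

Lemma radial_root_rad_cvg0 : W (rad x) @[x --> rho0^'+] --> (0 : R).
Proof.
apply/cvgrPdist_lt => e e0.
have [d /= d0 dW] : \forall r \near 0^'+, `|0 - W r| < e.
  by move/cvgrPdist_lt : radial_root_cvg0; apply.
near=> x; have x0 : rho0 < x by [].
apply: dW => /=; last exact: (rad_gt0 rad_inv x0).
near: x; move/cvgrPdist_lt : (rad_cvg0 rho0_gt0 m_smooth redshift_gt0 rad_inv).
by apply.
Unshelve. all: by end_near. Qed.

Lemma tame_radial_root_rad : tame (fun x => W (rad x)).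
Proof.
apply: tame_comp_rad => [r r0|].
  apply: differentiable_continuous; apply/derivable1_diffP.
  by case: (is_derive_radial_root m_smooth redshift_gt0 r0).
exists 1; near=> r; have : `|0 - W r| < 1.
  by near: r; move/cvgrPdist_lt : radial_root_cvg0; apply.
by rewrite sub0r normrN => /ltW.
Unshelve. all: by end_near. Qed.

Let xV n : tame (fun x => (x ^+ n)^-1) := tame_exprV n rho0_gt0.
Let tW := tame_radial_root_rad.
Let tr := tame_rad.
Let tm := tame_derive1n_rad.
Let tc (b : R) : tame (fun=> b) := tame_const b.

Lemma tame_energy_density : tame (energy_density G c m rad).
Proof. exact: tame_mul (tc _) (tame_mul (tame_mul tW (tm 1)) (xV 3)). Qed.

Lemma tame_stress_density : tame (stress_density G c m rad).
Proof. exact: tame_mul (tc _) (tame_mul (tame_mul (tame_mul tW tr) (tm 2)) (xV 3)). Qed.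

Let t1 : tame (fun x => rad x - k * m (rad x) - k * rad x * dm 1 (rad x)).
Proof.
exact: tame_sub (tame_sub tr (tame_mul (tc _) (tm 0))) (tame_mul (tame_mul (tc _) tr) (tm 1)).
Qed.

Lemma tame_energy_density1 : tame (energy_density1 G c m rad).
Proof.
exact: tame_mul (tame_mul (tc _) (xV 5)) (tame_sub (tame_add (tame_mul t1 (tm 1))
  (tame_mul (tame_sqr tW) (tm 2))) (tame_mul (tame_mul (tc _) tW) (tm 1))).
Qed.

Lemma tame_stress_density1 : tame (stress_density1 G c m rad).
Proof.
exact: tame_mul (tame_mul (tc _) (xV 5)) (tame_sub (tame_add (tame_add
  (tame_mul (tame_mul t1 tr) (tm 2)) (tame_mul (tame_sqr tW) (tm 2)))
  (tame_mul (tame_mul (tame_sqr tW) tr) (tm 3)))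
  (tame_mul (tame_mul (tame_mul (tc _) tW) tr) (tm 2))).
Qed.

Lemma tame_shear_density : tame (shear_density G c m rad).
Proof. exact: tame_mul (tame_sub tame_energy_density tame_stress_density) (xV 2). Qed.

Lemma tame_shear_density1 : tame (shear_density1 G c m rad).
Proof.
exact: tame_sub (tame_mul (tame_sub tame_energy_density1 tame_stress_density1) (xV 2))
  (tame_mul (tame_mul (tc _) tame_shear_density) (xV 2)).
Qed.

(* Both densities carry the factor [W (rad x)], which vanishes at the boundary. *)
Lemma density_boundary e : 0 < e -> exists2 d, 0 < d & forall x, rho0 < x < rho0 + d ->
  `|energy_density G c m rad x| < e /\ `|stress_density G c m rad x| < e.
Proof.
have dens (h : R -> R) : tame h -> forall e : R, 0 < e ->
    \forall x \near rho0^'+, `|W (rad x) * h x| < e.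
  move=> [_ /(_ (rho0 + 1))[C hC]] {}e e0; near=> x.
  have x0 : rho0 < x by [].
  have x1 : x <= rho0 + 1 by apply: ltW; near: x; apply: nbhs_right_lt; rewrite ltrDl.
  have C1 : 0 < `|C| + 1 by rewrite ltr_wpDl.
  have : `|0 - W (rad x)| < e / (`|C| + 1).
    by near: x; move/cvgrPdist_lt : radial_root_rad_cvg0; apply; rewrite divr_gt0.
  rewrite sub0r normrN normrM ltr_pdivlMr //; apply: le_lt_trans.
  rewrite ler_wpM2l // (le_trans (hC _ x0 x1)) // (le_trans (ler_norm C)) //.
  by rewrite lerDl.
move=> e0.
have /(_ e e0) dE := dens _ (tame_mul (tame_mul (tc (- (2 * k * c))) (tm 1)) (xV 3)).
have /(_ e e0) dS := dens _ (tame_mul (tame_mul (tame_mul (tc (- (k * c))) tr) (tm 2)) (xV 3)).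
have [d /= d0 dP] : \forall x \near rho0^'+,
    `|energy_density G c m rad x| < e /\ `|stress_density G c m rad x| < e.
  near=> x; split.
    rewrite (_ : energy_density _ _ _ _ _ =
      W (rad x) * (- (2 * k * c) * dm 1 (rad x) * (x ^+ 3)^-1)); first by near: x; exact: dE.
    by rewrite /energy_density; ring.
  rewrite (_ : stress_density _ _ _ _ _ =
    W (rad x) * (- (k * c) * rad x * dm 2 (rad x) * (x ^+ 3)^-1)); first by near: x; exact: dS.
  by rewrite /stress_density; ring.
exists d => // x /andP[x0 xd]; apply: dP => //=.
by rewrite distrC gtr0_norm ?subr_gt0 // ltrBlDl.
Unshelve. all: by end_near. Qed.

End RadialDensities.

(** * Test fields near the boundary *)

Section TestField.
Context {R : realType}.
Variables (rho0 : R) (psi : 'rV[R]_4 -> 'rV[R]_4).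
Local Notation M := (spacetime rho0).
Hypothesis psi_test : test_field rho0 psi.

Lemma closed_closed_spacetime : closed (closed_spacetime rho0).
Proof.
rewrite (_ : closed_spacetime rho0 = @rho_of R @^-1` [set x | rho0 <= x]) //.
by apply: closed_comp; [move=> p _; exact: rho_of_continuous|exact: closed_ge].
Qed.

(** Continuity in the open region gives no control at the boundary sphere. Local continuous
    extensions bound f near each point of the closed region, and compactness of its bounded part
    makes the bound uniform. *)
Lemma tame_locally_extendable (f : 'rV[R]_4 -> R) :
  (forall p, closed_spacetime rho0 p -> exists (U : set 'rV[R]_4) (F : 'rV[R]_4 -> R),
     [/\ open U, U p, {for p, continuous F} & forall q, M q -> U q -> f q = F q]) ->
  tame M Num.norm f.
Proof.
move=> fF; split=> [p Mp|K].
  have [|U [F [oU Up Fc FE]]] := fF p; first exact: ltW.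
  have fE : \forall q \near p, F q = f q.
    near=> q; apply/esym/FE; near: q; first exact: near_spacetime.
    exact: open_nbhs_nbhs.
  suff : f @ p --> F p by rewrite -(FE p Mp Up).
  exact: cvg_trans (near_eq_cvg fE) Fc.
pose A := closed_spacetime rho0 `&` [set p : 'rV[R]_4 | `|p| <= K].
have cA : compact A.
  apply: bounded_closed_compact.
    exists K; split; first exact: num_real.
    by move=> D KD p [_ /= pK]; exact: le_trans pK (ltW KD).
  apply: closedI; first exact: closed_closed_spacetime.
  rewrite (_ : [set p : 'rV[R]_4 | _] = Num.norm @^-1` [set x | x <= K]) //.
  by apply: closed_comp; [move=> p _; exact: norm_continuous|exact: closed_le].
(* Compactness as near-covering: the filter of constants tending to +oo takes the place of a maximum
   over a finite subcover. *)
have /compact_near_coveringP/(_ _ (pinfty_nbhs R) (fun C q => M q -> `|f q| <= C)) := cA.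
case=> [p [Mp _]|C [_ CP]].
  have [U [F [oU Up Fc FE]]] := fF p Mp.
  near=> q C => Mq /=; rewrite FE //; last by near: q; exact: open_nbhs_nbhs.
  apply: (@le_trans _ _ (`|F p| + 1)).
    have : `|F p - F q| < 1 by near: q; move/cvgrPdist_lt : Fc; apply.
    by rewrite distrC => Fpq; have := lerB_dist (F q) (F p); lra.
  by near: C; apply: nbhs_pinfty_ge; exact: num_real.
exists (C + 1) => p Mp pK; apply: (CP (C + 1)) => //; first by rewrite ltrDl.
by split => //; exact: ltW.
Unshelve. all: by end_near. Qed.

(** The partial derivatives are compared in the open region only, where [psi] equals F in a whole
    neighbourhood; at the boundary those of [psi] would involve its arbitrary values outside. *)
Lemma test_field_extension j p : closed_spacetime rho0 p ->
  exists (U : set 'rV[R]_4) (F : 'rV[R]_4 -> R), [/\ open U, U p, smooth_on_open U F,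
    (forall q, M q -> U q -> psi q 0 j = F q) &
    (forall i q, M q -> U q -> component_partial psi i j q = partial i F q)].
Proof.
move=> Mp; have [/(_ j p Mp)[U [F [oU Up sF FE]]] _] := psi_test.
have psiF q : M q -> U q -> psi q 0 j = F q.
  by move=> Mq Uq; rewrite FE // inE; split => //; exact: ltW.
exists U, F; split => // i q Mq Uq; rewrite /component_partial /partial.
apply: near_eq_derive; near=> w; apply: psiF; near: w; first exact: near_spacetime.
exact: open_nbhs_nbhs.
Unshelve. all: by end_near. Qed.

Lemma test_field_derivable i j p : M p ->
  derivable (fun q => psi q 0 j) p (delta_mx 0 i).
Proof.
move=> Mp; have [|U [F [oU Up sF FE _]]] := @test_field_extension j p; first exact: ltW.
have [_ /(_ i) dF] := sF [::] p Up.
apply: near_eq_derivable dF; near=> q; apply/esym/FE; near: q; first exact: near_spacetime.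
exact: open_nbhs_nbhs.
Unshelve. all: by end_near. Qed.

Lemma tame_test_field j : tame M Num.norm (fun p => psi p 0 j).
Proof.
apply: tame_locally_extendable => p Mp.
have [U [F [oU Up sF FE _]]] := @test_field_extension j p Mp.
by exists U, F; split => //; have [] := sF [::] p Up.
Qed.

Lemma tame_component_partial i j : tame M Num.norm (component_partial psi i j).
Proof.
apply: tame_locally_extendable => p Mp.
have [U [F [oU Up sF _ FE]]] := @test_field_extension j p Mp.
by exists U, (partial i F); split => //; [have [] := sF [:: i] p Up|exact: FE].
Qed.

Lemma test_field_support : exists2 K, 0 <= K & forall p, M p -> K < `|p| -> psi p = 0.
Proof.
have [_ /compact_bounded[K [_ KP]]] := psi_test.
exists (`|K| + 1) => [|p Mp pK]; first by rewrite addr_ge0.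
apply/eqP; apply: contraLR pK => psi0; rewrite -leNgt; apply: KP.
  by rewrite (le_lt_trans (ler_norm K)) // ltrDl.
by apply: subset_closure; split => //=; exact: ltW.
Qed.

Lemma component_partial_support K : (forall p, M p -> K < `|p| -> psi p = 0) ->
  forall i j p, M p -> K < `|p| -> component_partial psi i j p = 0.
Proof.
move=> psi0 i j p Mp pK; rewrite /component_partial /partial.
rewrite -[RHS](derive_cst (0 : R) p (delta_mx 0 i)).
apply: near_eq_derive; near=> q; rewrite psi0 ?mxE //; near: q; first exact: near_spacetime.
exact: (cvgr_gt _ (@norm_continuous _ _ p)).
Unshelve. all: by end_near. Qed.

End TestField.

(** * The weak Bianchi identity *)

Lemma det_mx2 (R : comNzRingType) (A : 'M[R]_2) :
  \det A = A 0 0 * A 1 1 - A 0 1 * A 1 0.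
Proof.
rewrite (expand_det_row _ 0) !big_ord_recl big_ord0 /cofactor !det_mx11 !mxE /=.
have -> : lift 0 0 = 1 :> 'I_2 by exact: val_inj.
have -> : lift 1 0 = 0 :> 'I_2 by exact: val_inj.
by rewrite !addn0 expr0 /= expr1; ring.
Qed.

Lemma det_mx3 (R : comNzRingType) (A : 'M[R]_3) :
  \det A = A 0 0 * (A 1 1 * A 2 2 - A 1 2 * A 2 1)
         - A 0 1 * (A 1 0 * A 2 2 - A 1 2 * A 2 0)
         + A 0 2 * (A 1 0 * A 2 1 - A 1 1 * A 2 0).
Proof.
rewrite (expand_det_row _ 0) !big_ord_recl big_ord0 /cofactor !det_mx2 !mxE /=.
have e1 : lift 0 0 = 1 :> 'I_3 by exact: val_inj.
have e2 : lift 0 1 = 2 :> 'I_3 by exact: val_inj.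
have e3 : lift 1 0 = 0 :> 'I_3 by exact: val_inj.
have e4 : lift 1 1 = 2 :> 'I_3 by exact: val_inj.
have e5 : lift 2 0 = 0 :> 'I_3 by exact: val_inj.
have e6 : lift 2 1 = 1 :> 'I_3 by exact: val_inj.
have e7 : lift 0 (lift 0 0) = 2 :> 'I_3 by exact: val_inj.
rewrite !(e7, e1, e2, e3, e4, e5, e6) /=.
by rewrite /bump /= !addn0 ?add0n expr0 expr1 sqrrN expr1n; ring.
Qed.

(** For the rows (X, d_t, d_theta, d_varphi) of the tube integrand, d_t = (1, 0, 0, 0) stands in row
    1. Expansion at position (1, 0) produces the sign that orients the tube. *)
Lemma det_mx4_time_row (R : comNzRingType) (A : 'M[R]_4) :
  A 1 0 = 1 -> A 1 1 = 0 -> A 1 2 = 0 -> A 1 3 = 0 ->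
  \det A = - (A 0 1 * (A 2 2 * A 3 3 - A 2 3 * A 3 2)
            - A 0 2 * (A 2 1 * A 3 3 - A 2 3 * A 3 1)
            + A 0 3 * (A 2 1 * A 3 2 - A 2 2 * A 3 1)).
Proof.
move=> a0 a1 a2 a3; rewrite (expand_det_row _ 1) sum_ord4 a0 a1 a2 a3.
rewrite !mul0r !addr0 mul1r /cofactor det_mx3 !mxE.
have e0 : lift 1 0 = 0 :> 'I_4 by exact: val_inj.
have e1 : lift 1 1 = 2 :> 'I_4 by exact: val_inj.
have e2 : lift 1 2 = 3 :> 'I_4 by exact: val_inj.
have f0 : lift 0 0 = 1 :> 'I_4 by exact: val_inj.
have f1 : lift 0 1 = 2 :> 'I_4 by exact: val_inj.
have f2 : lift 0 2 = 3 :> 'I_4 by exact: val_inj.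
by rewrite !(e0, e1, e2, f0, f1, f2) /= addn0 expr1; ring.
Qed.

Section WeakBianchi.
Context {R : realType}.
Variables (G c rho0 : R) (m rad : R -> R) (a : nat -> R).
Variables (g : 'rV[R]_4 -> 'M[R]_4) (psi : 'rV[R]_4 -> 'rV[R]_4).
Local Notation k := (G / c ^+ 2).
Local Notation M := (spacetime rho0).
Local Notation leb := (@lebesgue_measure R).
Local Notation RM := (measurableTypeR R).
Local Notation leb3 := (leb \x leb \x leb)%E.
Local Notation leb4 := (leb \x leb \x leb \x leb)%E.

Hypothesis G_gt0 : 0 < G.
Hypothesis c_gt0 : 0 < c.
Hypothesis rho0_gt0 : 0 < rho0.
Hypothesis m_smooth : smooth_on_pos m.
Hypothesis redshift_gt0 : forall r, 0 < r -> 0 < r ^+ 2 - 2 * k * r * m r.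
Hypothesis rad_inv : radial_inverse rho0 (conformal_radius G c rho0 m) rad.
Hypothesis m_series : abs_power_series_at0 m a.
Hypothesis gE : forall p, M p -> g p = diag_mx (row4 (- time_coeff G c m rad (rho_of p))
  (space_coeff rad (rho_of p)) (space_coeff rad (rho_of p)) (space_coeff rad (rho_of p))).
Hypothesis psi_test : test_field rho0 psi.

Let flux_ mu := flux G c m rad psi mu.
Let dflux mu := flux_derivative G c m rad psi mu.

Let tE := tame_radial (tame_energy_density rho0_gt0 m_smooth redshift_gt0 rad_inv m_series).
Let tS := tame_radial (tame_stress_density rho0_gt0 m_smooth redshift_gt0 rad_inv m_series).
Let tE1 := tame_radial (tame_energy_density1 rho0_gt0 m_smooth redshift_gt0 rad_inv m_series).
Let tS1 := tame_radial (tame_stress_density1 rho0_gt0 m_smooth redshift_gt0 rad_inv m_series).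
Let tH := tame_radial (tame_shear_density rho0_gt0 m_smooth redshift_gt0 rad_inv m_series).
Let tH1 := tame_radial (tame_shear_density1 rho0_gt0 m_smooth redshift_gt0 rad_inv m_series).
Let tX i := tame_space_coord M i.
Let tP j := tame_test_field psi_test j.
Let tD i j := tame_component_partial psi_test i j.
Let tc (b : R) : tame M Num.norm (fun=> b) := tame_const b.

Let tame_radial_part : tame M Num.norm (radial_part psi).
Proof.
exact: tame_add (tame_add (tame_mul (tX 1) (tP 1)) (tame_mul (tX 2) (tP 2)))
  (tame_mul (tX 3) (tP 3)).
Qed.

Let tame_flux_derivative mu : tame M Num.norm (dflux mu).
Proof.
have t1 := tame_add (tame_add (tame_mul (tX 1) (tD mu 1)) (tame_mul (tX 2) (tD mu 2)))
  (tame_mul (tX 3) (tD mu 3)).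
have t2 := tame_mul tH (tame_add (tame_mul (tX mu) (tame_add t1
  (tame_mul (tc (mu != 0)%:R) (tP mu)))) (tame_mul tame_radial_part (tc (mu != 0)%:R))).
have t3 := tame_mul (tame_mul (tX mu) tame_radial_part) (tame_mul tH1 (tX mu)).
rewrite /dflux /flux_derivative /diag_density /diag_density1.
case: (mu == 0) t1 t2 t3 => t1 t2 t3.
  exact: tame_add (tame_add (tame_mul tE (tD mu mu)) (tame_mul (tP mu) (tame_mul tE1 (tX mu))))
    (tame_add t2 t3).
exact: tame_add (tame_add (tame_mul tS (tD mu mu)) (tame_mul (tP mu) (tame_mul tS1 (tX mu))))
    (tame_add t2 t3).
Qed.

Lemma flux_boundary mu e : 0 < e -> exists2 d, 0 < d &
  forall p, rho0 < rho_of p < rho0 + d -> `|flux_ mu p| < e.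
Proof.
move=> e0; have [K K0 psi0] := test_field_support psi_test.
have [_ /(_ K)[C1 P1]] := tP mu.
have [_ /(_ K)[C2 P2]] := tame_mul (tame_mul (tX mu) tame_radial_part)
  (tame_radial (tame_exprV 2 rho0_gt0)).
(* C1 bounds psi and C2 the cofactor of energy - stress, a difference of two small terms, hence the
   2; the final 1 makes B positive and the estimate strict. *)
pose B := `|C1| + 2 * `|C2| + 1.
have B0 : 0 < B by rewrite ltr_wpDl // addr_ge0 // mulr_ge0.
have eB : 0 < e / B by rewrite divr_gt0.
have [d d0 dP] := density_boundary rho0_gt0 m_smooth redshift_gt0 rad_inv m_series eB.
exists d => // p /[dup] /andP[Mp _] /dP[Ep Sp].
rewrite /flux_ /flux; have [pK|pK] := leP `|p| K; last first.
  by rewrite /radial_part psi0 // !mxE !(mulr0, addr0) normr0.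
have Dp : `|diag_density G c m rad mu (rho_of p)| <= e / B.
  by rewrite /diag_density; case: ifP => _; exact: ltW.
have -> : shear_density G c m rad (rho_of p) * (space_coord p mu * radial_part psi p) =
    (energy_density G c m rad (rho_of p) - stress_density G c m rad (rho_of p)) *
    (space_coord p mu * radial_part psi p * (rho_of p ^+ 2)^-1).
  by rewrite /shear_density; ring.
have {}P1 := le_trans (P1 p Mp pK) (ler_norm C1).
have {}P2 := le_trans (P2 p Mp pK) (ler_norm C2).
have h1 : `|diag_density G c m rad mu (rho_of p) * psi p 0 mu| <= e / B * `|C1|.
  by rewrite normrM ler_pM.
have h2 : `|(energy_density G c m rad (rho_of p) - stress_density G c m rad (rho_of p)) *
    (space_coord p mu * radial_part psi p * (rho_of p ^+ 2)^-1)| <= (e / B + e / B) * `|C2|.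
  rewrite normrM ler_pM // (le_trans (ler_normB _ _)) //.
  by apply: lerD; exact: ltW.
apply: (le_lt_trans (ler_normD _ _)); apply: (le_lt_trans (lerD h1 h2)).
rewrite (_ : e / B * `|C1| + _ = e / B * (B - 1)); last by rewrite /B; ring.
by rewrite -[ltRHS](divfK (lt0r_neq0 B0)) ltr_pM2l // gtrDl oppr_lt0.
Qed.

Lemma flux_support : exists K, forall mu p, M p -> K < `|p| ->
  flux_ mu p = 0 /\ dflux mu p = 0.
Proof.
have [K K0 psi0] := test_field_support psi_test; exists K => mu p Mp pK.
rewrite /flux_ /flux /dflux /flux_derivative /radial_part.
rewrite !(component_partial_support psi0) // psi0 // !mxE.
by split; rewrite !(mulr0, mul0r, addr0).
Qed.

Let coordinate_slice mu (z : RM * RM * RM * RM) : R :=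
  if rho0 < rho_of (point4 z) then dflux mu (point4 z) else 0.

Let coordinate_slice_spec mu :
  leb4.-integrable setT (EFin \o coordinate_slice mu) /\
  (\int[leb4]_z (coordinate_slice mu z)%:E = 0)%E.
Proof.
have [K supp] := flux_support.
have [dc /(_ K)[C dC]] := tame_flux_derivative mu.
have dC' p : M p -> `|dflux mu p| <= `|C|.
  move=> Mp; have [/(dC p Mp) h|pK] := leP `|p| K; first exact: le_trans h (ler_norm C).
  by have [_ ->] := supp mu p Mp pK; rewrite normr0.
have s1 p i : M p -> K < `|p 0 i| -> flux_ mu p = 0.
  by move=> Mp pK; have [] := supp mu p Mp (lt_le_trans pK (ler_norm_entry p i)).
have s2 p i : M p -> K < `|p 0 i| -> dflux mu p = 0.
  by move=> Mp pK; have [] := supp mu p Mp (lt_le_trans pK (ler_norm_entry p i)).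
have fd p : M p -> is_derive p (delta_mx 0 mu) (flux_ mu) (dflux mu p).
  move=> Mp; apply: (is_derive_flux rho0_gt0 m_smooth redshift_gt0 rad_inv Mp) => nu.
  exact: (test_field_derivable psi_test).
split; first exact: coordinate_integrable dc dC' s2.
exact: coordinate_integral_eq0 rho0_gt0 fd dc dC' s1 s2 (flux_boundary mu).
Qed.

Let bulk_mkcond : (EFin \o bulk_integrand g psi) \_ (bulk_domain rho0) =
  fun z => (\sum_(mu : 'I_4) (coordinate_slice mu z)%:E)%E.
Proof.
apply/funext => z; rewrite patchE sumEFin /bulk_integrand /coordinate_slice /=.
case: ifPn => [|/negP]; rewrite inE => zM.
  rewrite (einstein_divergence G_gt0 c_gt0 rho0_gt0 m_smooth redshift_gt0 rad_inv gE) //.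
  by congr EFin; apply: eq_bigr => mu _; rewrite ifT.
by rewrite big1 // => mu _; rewrite ifF //; exact/negP.
Qed.

Let measurable_bulk_domain : measurable (bulk_domain rho0 : set (RM * RM * RM * RM)).
Proof. exact: measurable_point4 (open_spacetime (rho0 := rho0)). Qed.

Lemma bulk_integrable_flux : bulk_integrable rho0 g psi.
Proof.
apply/(integrable_mkcond _ measurable_bulk_domain); rewrite bulk_mkcond.
by apply: integrable_sum => // mu _; have [] := coordinate_slice_spec mu.
Qed.

Lemma bulk_integral_eq0 : bulk_integral rho0 g psi = 0.
Proof.
rewrite /bulk_integral /Rintegral integral_mkcond.
rewrite [X in integral _ _ X](_ : _ = fun z => (\sum_(mu : 'I_4) (coordinate_slice mu z)%:E)%E).
  rewrite (@integral_sum _ _ _ _ _ measurableT _ (fun mu z => (coordinate_slice mu z)%:E)).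
    by rewrite big1 // => mu _; have [] := coordinate_slice_spec mu.
  by move=> mu; have [] := coordinate_slice_spec mu.
exact: bulk_mkcond.
Qed.

(** The sphere sees only the radial part of the flux, whose eigenvalue is the energy one. The area
    factor rho^2 sin theta has lost one rho to [radial_part], which is rho times the radial
    component; the minus sign is the normal -d_rho. *)
Lemma tube_integrandE rho (z : R * R * R) : rho0 < rho ->
  tube_integrand g (einstein_flux_field g psi) rho z =
  - (energy_density G c m rad rho * rho * sin z.1.2 *
     radial_part psi (spherical_chart id (row4 z.1.1 rho z.1.2 z.2))).
Proof.
move=> rho_gt; have rhop : 0 < rho by exact: lt_trans rho_gt.
rewrite /tube_integrand /vol_form; set q := row4 _ _ _ _; set p := spherical_chart id q.
have rhoE : rho_of p = rho by rewrite rho_of_spherical_chart row4E.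
have Mp : M p by rewrite /spacetime /= rhoE.
have x1 : space_coord p 1 = rho * (sin z.1.2 * cos z.2).
  by rewrite /space_coord /p /spherical_chart !row4E.
have x2 : space_coord p 2 = rho * (sin z.1.2 * sin z.2).
  by rewrite /space_coord /p /spherical_chart !row4E.
have x3 : space_coord p 3 = rho * cos z.1.2.
  by rewrite /space_coord /p /spherical_chart !row4E.
have := spherical_jacobian q; rewrite !row4E; move: ('J _ q) => J JE.
set A := \matrix_i _.
have A0 j : A 0 j = einstein_flux_field g psi p 0 j by rewrite mxE.
have A1 j : A 1 j = J 0 j by rewrite mxE /= mxE.
have A2 j : A 2 j = J 2 j by rewrite mxE /= mxE.
have A3 j : A 3 j = J 3 j by rewrite mxE /= mxE.
rewrite det_mx4_time_row ?A1 ?JE // !A0 !A2 !A3 !JE /=.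
set X := einstein_flux_field g psi p.
(* The third component of the cross product of d_theta and d_varphi carries cos^2 + sin^2 of varphi;
   it is kept visible so that [ring] closes the step. *)
transitivity (- (rho * sin z.1.2 * (X 0 1 * vol_density g p * space_coord p 1
    + X 0 2 * vol_density g p * space_coord p 2
    + X 0 3 * vol_density g p * (space_coord p 3 * (cos z.2 ^+ 2 + sin z.2 ^+ 2))))).
  by rewrite x1 x2 x3; ring.
rewrite cos2Dsin2 mulr1 !(flux_fieldE G_gt0 c_gt0 rho0_gt0 m_smooth redshift_gt0 rad_inv gE) //.
rewrite /flux /diag_density /= /shear_density.
transitivity (- (rho * sin z.1.2 * (stress_density G c m rad (rho_of p) * radial_part psi p
  + (energy_density G c m rad (rho_of p) - stress_density G c m rad (rho_of p))
    / rho_of p ^+ 2 * radial_part psi p * (space_coord p 1 ^+ 2 + space_coord p 2 ^+ 2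
      + space_coord p 3 ^+ 2)))).
  by rewrite /radial_part; ring.
rewrite space_coord_sqr rhoE; field; rewrite gt_eqF //.
Qed.

Lemma radial_part_bounded : exists K C : R, [/\ 0 <= C,
  forall p, M p -> `|radial_part psi p| <= C &
  forall p, M p -> K < `|p| -> radial_part psi p = 0].
Proof.
have [K K0 psi0] := test_field_support psi_test.
have rp0 p : M p -> K < `|p| -> radial_part psi p = 0.
  by move=> Mp pK; rewrite /radial_part psi0 // !mxE !(mulr0, addr0).
have [_ /(_ K)[C Cb]] := tame_radial_part; exists K, `|C|; split => // p Mp.
have [/(Cb p Mp) h|pK] := leP `|p| K; first exact: le_trans h (ler_norm C).
by rewrite rp0 // normr0.
Qed.

(** * The integral over a tube of fixed radius *)

Section Tube.
Variables (K C rho : R).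
Hypothesis C0 : 0 <= C.
Hypothesis rp_bound : forall p, M p -> `|radial_part psi p| <= C.
Hypothesis rp_support : forall p, M p -> K < `|p| -> radial_part psi p = 0.
Hypothesis rho_gt : rho0 < rho.

Let tube (z : RM * RM * RM) : R := tube_integrand g (einstein_flux_field g psi) rho z.
Let chart (z : RM * RM * RM) : 'rV[R]_4 :=
  spherical_chart id (row4 z.1.1 rho z.1.2 z.2).
Let slab : set (RM * RM * RM) :=
  `[(- K)%R, K]%classic `*` `]0%R, pi[%classic `*` `]0%R, (2 * pi)%R[%classic.

Let rhop : 0 < rho. Proof. exact: lt_trans rho_gt. Qed.

Let M_chart z : M (chart z).
Proof. by rewrite /spacetime /= rho_of_spherical_chart row4E. Qed.

Let measurable_tube : measurable_fun setT tube.
Proof.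
pose U : set 'rV[R]_4 := [set q | rho0 < q 0 1].
have oU : open U.
  apply: (@open_comp _ _ (fun q : 'rV[R]_4 => q 0 1) [set x | rho0 < x]); last exact: open_gt.
  by move=> q _; exact: coord_continuous.
pose h (q : 'rV[R]_4) := - (energy_density G c m rad rho * rho * sin (q 0 2) *
  radial_part psi (spherical_chart id q)).
have hc q : U q -> {for q, continuous h}.
  move=> Uq; have q0 : 0 < q 0 1 by exact: lt_trans Uq.
  apply: continuousN; apply: continuousM.
    apply: continuousM; first exact: cst_continuous.
    apply: (@continuous_comp _ _ _ (fun q : 'rV[R]_4 => q 0 2) sin).
      exact: coord_continuous.
    exact: continuous_sin.
  apply: (@continuous_comp _ _ _ (spherical_chart id) (radial_part psi)).
    exact: differentiable_continuous (spherical_chart_differentiable q).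
  have [rc _] := tame_radial_part; apply: rc.
  by rewrite /spacetime /= rho_of_spherical_chart.
have mh := measurable_fun_point4 oU hc.
(* The tube integrand is the restriction to fixed rho of a function continuous in all four spherical
   coordinates, so measurability comes from four dimensions. *)
pose emb (z : RM * RM * RM) : RM * RM * RM * RM := (z.1.1, rho, z.1.2, z.2).
rewrite (_ : tube = (h \o @point4 R) \o emb); last first.
  by apply/funext => z; rewrite /tube tube_integrandE // /h /point4 /= !row4E.
apply: (measurable_comp (measurable_point4 oU) _ mh).
  by move=> _ [z _ <-]; rewrite /U /point4 /= row4E.
do 3?apply: measurable_fun_pair => //; apply: measurableT_comp => //.
Qed.

Let tube_bound z : `|tube z| <= `|energy_density G c m rad rho| * rho * C.
Proof.
rewrite /tube tube_integrandE //; move: (energy_density _ _ _ _ _) => E.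
rewrite normrN !normrM (gtr0_norm rhop) -!mulrA; apply: ler_wpM2l; first exact: normr_ge0.
apply: ler_wpM2l; first exact: ltW.
have s1 : `|sin z.1.2| <= 1 by rewrite ler_norml sin_geN1 sin_le1.
by rewrite -[leRHS]mul1r; apply: ler_pM => //; apply: rp_bound; exact: M_chart.
Qed.

(** Since |t| is at most the norm of the point, the support confines t to [-K, K]. The infinite tube
    becomes a slab of finite measure, the same for every rho. *)
Let tube_slab : (EFin \o tube) \_ tube_domain = (EFin \o tube) \_ slab.
Proof.
apply/funext => z; rewrite !patchE.
have [zK|Kz] := leP `|z.1.1| K.
  rewrite (_ : (z \in tube_domain) = (z \in slab)) //.
  apply/idP/idP; rewrite !inE => -[[z1 z2] z3]; split => //; split => //.
  by rewrite /= in_itv /= -ler_norml.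
have -> : (EFin \o tube) z = 0%E; last by do 2!case: ifP.
rewrite /= /tube tube_integrandE //; congr EFin.
rewrite rp_support ?mulr0 ?oppr0 //; first exact: M_chart.
apply: (lt_le_trans Kz).
by rewrite (le_trans _ (ler_norm_entry _ 0)) // /spherical_chart !row4E.
Qed.

Let mslab : measurable slab.
Proof. by do 2?apply: measurableX => //; exact: measurable_itv. Qed.

Let mtube_domain : measurable (tube_domain : set (RM * RM * RM)).
Proof. by do 2?apply: measurableX => //; exact: measurable_itv. Qed.

Let slab_lty : (leb3 slab < +oo)%E.
Proof.
have itv_lty (x y : R) b1 b2 :
    (leb [set` Interval (BSide b1 x) (BSide b2 y)] < +oo)%E.
  by rewrite lebesgue_measure_itv /=; case: ifP => _; exact: ltry.
apply: product_measure_lty; [|exact: measurable_itv| |exact: itv_lty].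
  by apply: measurableX; exact: measurable_itv.
by apply: product_measure_lty; [exact: measurable_itv|exact: measurable_itv|
  exact: itv_lty|exact: itv_lty].
Qed.

Let itube_slab : leb3.-integrable slab (EFin \o tube).
Proof.
apply: measurable_bounded_integrable => //; first exact: measurable_funTS.
exists (`|energy_density G c m rad rho| * rho * C); split; first exact: num_real.
by move=> D CD z _; exact: le_trans (tube_bound z) (ltW CD).
Qed.

Lemma tube_integrable_flux : tube_integrable g (einstein_flux_field g psi) rho.
Proof.
apply/(integrable_mkcond _ mtube_domain).
by rewrite [X in integrable _ _ X]tube_slab; apply/(integrable_mkcond _ mslab).
Qed.

Lemma tube_integral_le : `|tube_integral g (einstein_flux_field g psi) rho| <=
  `|energy_density G c m rad rho| * rho * C * fine (leb3 slab).
Proof.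
rewrite /tube_integral /Rintegral integral_mkcond [X in integral _ _ X]tube_slab.
rewrite -integral_mkcond.
apply: normr_Rintegral_le => //; first exact: measurable_funTS.
by rewrite !mulr_ge0 // ltW.
Qed.

End Tube.

Lemma weak_bianchi_field : let X := einstein_flux_field g psi in
  [/\ bulk_integrable rho0 g psi,
      forall eps : R, 0 < eps -> tube_integrable g X (rho0 + eps),
      tube_integral g X (rho0 + eps) @[eps --> 0^'+] --> bulk_integral rho0 g psi
    & bulk_integral rho0 g psi = 0].
Proof.
have [K [C [C0 rpC rp0]]] := radial_part_bounded.
split; first exact: bulk_integrable_flux.
- by move=> eps eps0; apply: (tube_integrable_flux rpC rp0); rewrite ltrDl.
- rewrite bulk_integral_eq0; apply/cvgrPdist_lt => e e0.
  set V := fine (leb3 (`[(- K)%R, K]%classic `*` `]0%R, pi[%classic `*`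
    `]0%R, (2 * pi)%R[%classic)).
  have V0 : 0 <= V by rewrite fine_ge0.
  (* Bounds the factor of the energy density in the tube estimate for eps < 1; dividing by B + 1
     makes the final inequality strict. *)
  pose B := (rho0 + 1) * C * V.
  have B0 : 0 <= B by rewrite !mulr_ge0 // addr_ge0 // ltW.
  have B1 : 0 < B + 1 by rewrite ltr_wpDl.
  have eB : 0 < e / (B + 1) by rewrite divr_gt0.
  have [d d0 dP] := density_boundary rho0_gt0 m_smooth redshift_gt0 rad_inv m_series eB.
  near=> eps; have eps0 : 0 < eps by [].
  have eps1 : eps < 1 by near: eps; exact: nbhs_right_lt.
  have epsd : eps < d by near: eps; exact: nbhs_right_lt.
  have rho_gt : rho0 < rho0 + eps by rewrite ltrDl.
  rewrite sub0r normrN; apply: le_lt_trans (tube_integral_le C0 rpC rp0 rho_gt) _.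
  have [|Ee _] := dP (rho0 + eps); first by rewrite rho_gt ltrD2l.
  apply: (@le_lt_trans _ _ (e / (B + 1) * B)).
    have -> (E x : R) : E * x * C * V = E * (x * C * V) by rewrite !mulrA.
    apply: ler_pM; [exact: normr_ge0| |exact: ltW|].
      by rewrite !mulr_ge0 // addr_ge0 // ltW.
    by rewrite /B -!(mulrA _ C); apply: ler_wpM2r; [exact: mulr_ge0|rewrite lerD2l ltW].
  by rewrite -[ltRHS](divfK (lt0r_neq0 B1)) ltr_pM2l // ltrDl.
- exact: bulk_integral_eq0.
Unshelve. all: by end_near. Qed.

End WeakBianchi.

Theorem corollary2p3 (R : realType) (G c rho0 : R)
    (g : 'rV[R]_4 -> 'M[R]_4) (alpha m rad : R -> R) (a : nat -> R) :
  0 < G -> 0 < c -> 0 < rho0 ->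
  smooth_lorentzian_metric (spacetime rho0) g ->
  radial_inverse rho0 (conformal_radius G c rho0 m) rad ->
  conformally_flat_form c rho0
    (fun rho => alpha (rad rho)) (fun rho => Num.sqrt (rad rho / rho)) g ->
  area_radius_form c alpha (conformal_radius G c rho0 m) g ->
  smooth_on_pos m ->
  (forall r : R, 0 < r -> expR (2 * alpha r) = 1 - 2 * G * m r / (c ^+ 2 * r)) ->
  abs_power_series_at0 m a ->
  a 0%N < 0 ->
  weak_bianchi rho0 g.
Proof.
move=> G0 c0 rho00 [g_smooth _] rad_inv gflat _ m_smooth alphaE m_series _ psi psi_test.
(* The radicand W^2 is r^2 e^(2 alpha); this yields its positivity and identifies N with
   [time_coeff]. *)
have redshiftE r : 0 < r ->
    r ^+ 2 - 2 * (G / c ^+ 2) * r * m r = r ^+ 2 * expR (2 * alpha r).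
  by move=> r0; rewrite alphaE //; field; rewrite !gt_eqF.
have redshift_gt0 r : 0 < r -> 0 < r ^+ 2 - 2 * (G / c ^+ 2) * r * m r.
  by move=> r0; rewrite redshiftE // mulr_gt0 ?expR_gt0 // exprn_gt0.
have gE p : spacetime rho0 p -> g p = diag_mx (row4 (- time_coeff G c m rad (rho_of p))
    (space_coeff rad (rho_of p)) (space_coeff rad (rho_of p)) (space_coeff rad (rho_of p))).
  apply: (conformally_flat_metric rho00 _ gflat) => {p} [p pM i j|x x0|x x0|x x0].
  - by have [] := g_smooth i j [::] p pM.
  - have r0 := rad_gt0 rad_inv x0.
    by rewrite /time_coeff radial_root_sqr // redshiftE //; field; rewrite gt_eqF.
  - have r0 := rad_gt0 rad_inv x0; have xp := lt_trans rho00 x0.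
    rewrite (_ : 4%N = (2 * 2)%N) // exprM sqr_sqrtr ?divr_ge0 ?ltW //.
    by rewrite /space_coeff expr_div_n.
  - split; apply: differentiable_continuous; apply/derivable1_diffP.
      by case: (is_derive_time_coeff G0 c0 rho00 m_smooth redshift_gt0 rad_inv x0).
    by case: (is_derive_space_coeff rho00 m_smooth redshift_gt0 rad_inv x0).
exact: (weak_bianchi_field G0 c0 rho00 m_smooth redshift_gt0 rad_inv m_series gE psi_test).
Qed.
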